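(* Let $r\in(0,1)$ and $L>0$. Consider either the Dirichlet or the Neumann Laplacian in $L^2(0,L)$ and, for each integer $M\ge 1$, let $E_M\subset L^2(0,L)$ be the linear span of its first $M$ eigenfunctions. Then for each $M\ge 1$ there exist centers $c_1^M,\dots,c_M^M\in(0,L)$ such that the corresponding intervals $$\omega_j^M:=\Big(c_j^M-\tfrac{rL}{2M},\,c_j^M+\tfrac{rL}{2M}\Big)\subset(0,L),\qquad j\in\{1,\dots,M\},$$ are pairwise disjoint, and the sequence of linear spans $U_M:=\operatorname{span}\{1_{\omega_1^M},\dots,1_{\omega_M^M}\}$ satisfies $$L^2(0,L)=U_M\oplus E_M^\perp\quad\text{for all }M\ge 1,$$ and there is a constant $C_P\ge 1$, independent of $M$, such that $$\big\|P_{U_M}^{E_M^\perp}\big\|_{\mathcal L(L^2(0,L))}\le C_P\quad\text{for all }M\ge 1.$$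
   Context: $1_\omega$ denotes the indicator function of $\omega\subset(0,L)$. $E_M^\perp$ is the orthogonal complement of $E_M$ in $L^2(0,L)$. Eigenfunctions of $-\Delta=-\frac{d^2}{dx^2}$ on $(0,L)$ under homogeneous Dirichlet (respectively Neumann) boundary conditions are ordered by increasing eigenvalue: in the Dirichlet case the $i$-th eigenfunction is a multiple of $\sin(i\pi x/L)$, $i\ge1$; in the Neumann case the $i$-th eigenfunction is a multiple of $\cos((i-1)\pi x/L)$, $i\ge 1$. Oblique projection: if a Hilbert space $H$ is a direct sum $H=F\oplus E$ of closed subspaces, $P_F^E:H\to F$ denotes the projection onto $F$ along $E$, i.e. $P_F^E x=x_F$ where $x=x_F+x_E$ is the unique decomposition with $(x_F,x_E)\in F\times E$. $\|\cdot\|_{\mathcal L(L^2(0,L))}$ is the operator norm. *)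

(* Defs.v *)
From HB Require Import structures.
From mathcomp Require Import all_boot all_order all_algebra.
From mathcomp Require Import all_classical all_reals all_analysis.
From mathcomp Require Import measurable_realfun ess_sup_inf.

Set Implicit Arguments.
Unset Strict Implicit.
Unset Printing Implicit Defensive.

Import Order.TTheory GRing.Theory Num.Theory.
Import numFieldNormedType.Exports.

Local Open Scope classical_set_scope.
Local Open Scope ring_scope.

(* The library's LspaceType (classes of a.e. equal functions with finite
   p-norm) carries no algebraic structure; here it becomes an lmodType, with
   the operations induced by those of LfunType on representatives. *)
Section Lspace_lmodType.
Context d (T : measurableType d) (R : realType).
Variables (mu : {measure set T -> \bar R}) (p : \bar R) (p1 : (1 <= p)%E).

Local Notation Lp := (LspaceType mu p1).
Local Notation fn := (LfunType mu p1).

Lemma ae_eq_Lnorm (q : \bar R) (f g : {mfun T >-> measurableTypeR R}) :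
  (1 <= q)%E -> f = g %[ae mu] ->
  ('N[mu]_q[EFin \o f] = 'N[mu]_q[EFin \o g])%E.
Proof.
move=> q1 fg.
have mh (h : {mfun T >-> measurableTypeR R}) r :
    measurable_fun setT (fun x => (`|(h x : R)%:E| `^ r)%E : \bar R).
  apply: (measurableT_comp (measurable_poweR _)) => //.
  apply: measurableT_comp => //.
  by apply/measurable_EFinP; exact: (@measurable_funPT _ _ _ _ h).
rewrite unlock /Lnorm; case: q q1 => [r r1|_|//].
- congr (_ `^ _)%E; apply: ge0_ae_eq_integral => //.
  + exact: mh.
  + exact: mh.
  + by move=> x _; exact: poweR_ge0.
  + by move=> x _; exact: poweR_ge0.
  + by apply: filterS fg => x /(_ I)/= + _ => ->.
- case: ifP => // _; apply: eq_ess_sup.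
  by apply: filterS fg => x /(_ I)/= ->.
Qed.

Lemma ae_eq_finite_norm (f g : {mfun T >-> measurableTypeR R}) :
  f = g %[ae mu] -> finite_norm mu p f -> finite_norm mu p g.
Proof. by rewrite /finite_norm => /(ae_eq_Lnorm p1) ->. Qed.

Lemma repr_pi_ae (f : {mfun T >-> measurableTypeR R}) :
  repr (\pi_({mfun_ mu, T >-> measurableTypeR R})%qT f) = f %[ae mu].
Proof.
have /eqP := reprK (\pi_({mfun_ mu, T >-> measurableTypeR R})%qT f).
by rewrite eqmodE => /asboolP.
Qed.

Definition Lmfun (f : fn) : {mfun T >-> measurableTypeR R} :=
  HB.pack_for {mfun T >-> measurableTypeR R} (f : T -> measurableTypeR R)
    (isMeasurableFun.Build _ _ T (measurableTypeR R) f
      (@measurable_funPT _ _ _ _ f)).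

Lemma Lclass_subproof (f : fn) :
  finite_norm mu p (\pi_({mfun_ mu, T >-> measurableTypeR R})%qT (Lmfun f)
    : {mfun_ mu, T >-> measurableTypeR R}).
Proof.
apply: (@ae_eq_finite_norm (Lmfun f)); last exact: (@Lfunction_finite _ _ _ _ _ _ f).
exact: ae_eq_sym (repr_pi_ae (Lmfun f)).
Qed.

Definition Lclass (f : fn) : Lp :=
  HB.pack_for Lp
    (\pi_({mfun_ mu, T >-> measurableTypeR R})%qT (Lmfun f)
      : {mfun_ mu, T >-> measurableTypeR R})
    (isFinLebesgue.Build d T R mu p p1 _ (Lclass_subproof f)).

Lemma Lclass_ae (f : fn) : Lclass f = f %[ae mu].
Proof. exact: repr_pi_ae. Qed.

Lemma LspaceP (F G : Lp) : F = G %[ae mu] -> F = G.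
Proof.
move=> FG.
have FGs : (F : {mfun_ mu, T >-> measurableTypeR R}) = G.
  rewrite -[LHS]reprK -[RHS]reprK; apply/eqP; rewrite eqmodE; exact/asboolP.
case: F G FGs {FG} => [F [[cF]]] [G [[cG]]] /= FG; case: _ / FG cG => cG.
by rewrite (Prop_irrelevance cF cG).
Qed.

Lemma Lrepr_subproof (F : Lp) :
  (repr (F : {mfun_ mu, T >-> measurableTypeR R}) : T -> R) \in Lfun mu p.
Proof.
rewrite inE; apply/andP; split; rewrite inE/=.
  exact: (@measurable_funPT _ _ _ _ (repr (F : {mfun_ mu, T >-> _}))).
exact: (@Lebesgue_finite _ _ _ _ _ _ F).
Qed.

Definition Lrepr (F : Lp) : fn := Lfun_Sub p1 (Lrepr_subproof F).

Lemma Lrepr_class (f : fn) : Lrepr (Lclass f) = f %[ae mu].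
Proof. exact: Lclass_ae. Qed.

Lemma eq_Lclass (f g : fn) : f = g %[ae mu] -> Lclass f = Lclass g.
Proof.
move=> fg; apply: LspaceP.
apply: ae_eq_trans (Lclass_ae f) (ae_eq_trans fg _).
exact: ae_eq_sym (Lclass_ae g).
Qed.

Lemma LreprK (F : Lp) : Lclass (Lrepr F) = F.
Proof. by apply: LspaceP; exact: Lclass_ae. Qed.

HB.instance Definition _ := gen_eqMixin Lp.
HB.instance Definition _ := gen_choiceMixin Lp.

Definition Lspace_add (F G : Lp) : Lp := Lclass (Lrepr F + Lrepr G).
Definition Lspace_opp (F : Lp) : Lp := Lclass (- Lrepr F).
Definition Lspace_scale (a : R) (F : Lp) : Lp := Lclass (a *: Lrepr F).

Lemma Lclass_add (f g : fn) : Lspace_add (Lclass f) (Lclass g) = Lclass (f + g).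
Proof.
apply: eq_Lclass; have := Lrepr_class f; have := Lrepr_class g.
by apply: filterS2 => x /(_ I) gE /(_ I) fE _; exact: (congr2 +%R fE gE).
Qed.

Lemma Lclass_opp (f : fn) : Lspace_opp (Lclass f) = Lclass (- f).
Proof.
apply: eq_Lclass; have := Lrepr_class f.
by apply: filterS => x /(_ I) fE _; exact: (congr1 -%R fE).
Qed.

Lemma Lclass_scale a (f : fn) : Lspace_scale a (Lclass f) = Lclass (a *: f).
Proof.
apply: eq_Lclass; have := Lrepr_class f.
by apply: filterS => x /(_ I) fE _; exact: (congr1 ( *%R a) fE).
Qed.

Lemma Lspace_addA : associative Lspace_add.
Proof.
move=> F G H; rewrite -(LreprK F) -(LreprK G) -(LreprK H).
by rewrite !Lclass_add addrA.
Qed.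

Lemma Lspace_addC : commutative Lspace_add.
Proof. by move=> F G; rewrite /Lspace_add addrC. Qed.

Lemma Lspace_add0 : left_id (Lclass 0) Lspace_add.
Proof. by move=> F; rewrite -(LreprK F) Lclass_add add0r. Qed.

Lemma Lspace_addN : left_inverse (Lclass 0) Lspace_opp Lspace_add.
Proof. by move=> F; rewrite -(LreprK F) Lclass_opp Lclass_add addNr. Qed.

HB.instance Definition _ := GRing.isZmodule.Build Lp
  Lspace_addA Lspace_addC Lspace_add0 Lspace_addN.

Lemma LclassD (f g : fn) : Lclass (f + g) = Lclass f + Lclass g.
Proof. by rewrite -Lclass_add. Qed.

Lemma Lspace_scaleA a b F :
  Lspace_scale a (Lspace_scale b F) = Lspace_scale (a * b) F.
Proof. by rewrite -(LreprK F) !Lclass_scale scalerA. Qed.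

Lemma Lspace_scale1 : left_id 1 Lspace_scale.
Proof. by move=> F; rewrite -(LreprK F) !Lclass_scale scale1r. Qed.

Lemma Lspace_scaleDr : right_distributive Lspace_scale +%R.
Proof.
move=> a F G; rewrite -(LreprK F) -(LreprK G).
by rewrite -LclassD !Lclass_scale scalerDr LclassD.
Qed.

Lemma Lspace_scaleDl F : {morph Lspace_scale^~ F : a b / a + b}.
Proof.
by move=> a b; rewrite -(LreprK F) !Lclass_scale scalerDl LclassD.
Qed.

HB.instance Definition _ := GRing.Zmodule_isLmodule.Build R Lp
  Lspace_scaleA Lspace_scale1 Lspace_scaleDr Lspace_scaleDl.

Lemma LclassZ a (f : fn) : Lclass (a *: f) = a *: Lclass f.
Proof. by rewrite -Lclass_scale. Qed.

End Lspace_lmodType.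

Section subspaces.
Context (R : realType) (V : lmodType R).

Definition lin_span n (v : 'I_n -> V) : set V :=
  [set \sum_(i < n) a i *: v i | a in [set: 'I_n -> R]].

Definition direct_sum (F E : set V) : Prop :=
  forall x, exists! yz : V * V, [/\ F yz.1, E yz.2 & x = yz.1 + yz.2].

(* The projection onto F along E; meaningful when [direct_sum F E]. *)
Definition oblique_proj (F E : set V) (x : V) : V :=
  xget 0 [set y | F y /\ E (x - y)].

End subspaces.

Section L2_general.
Context d (T : measurableType d) (R : realType).
Variable mu : {measure set T -> \bar R}.

Definition L2_inner (F G : LspaceType2 mu) : R := \int[mu]_x (F x * G x).

Definition L2_orth (E : set (LspaceType2 mu)) : set (LspaceType2 mu) :=
  [set F | forall G, E G -> L2_inner F G = 0].

Definition L2_norm (F : LspaceType2 mu) : \bar R := 'N[mu]_2[EFin \o F]%E.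

Definition L2_opnorm (A : LspaceType2 mu -> LspaceType2 mu) : \bar R :=
  ereal_sup [set L2_norm (A F) | F in [set F | (L2_norm F <= 1)%E]].

Lemma indic_Lfun2 (A : set T) : measurable A -> (mu A < +oo)%E ->
  (\1_A : T -> R) \in Lfun mu 2.
Proof.
move=> mA muA; rewrite inE; apply/andP; split; rewrite inE/=.
  exact: measurable_indic.
rewrite /finite_norm unlock /Lnorm; apply: poweR_lty.
rewrite [ltLHS](_ : _ = mu A)// -[in RHS](setIT A) -integral_indic//.
apply: eq_integral => x _; rewrite /= indicE.
by case: (x \in A); rewrite ?normr1 ?powR1 ?normr0 ?powR0.
Qed.

End L2_general.

Section interval.
Context {R : realType}.

(* L^2(0, L): functions on R modulo equality a.e. on ]0, L[. *)
Definition lebesgue0 (L : R) : {measure set (measurableTypeR R) -> \bar R} :=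
  mrestr (@lebesgue_measure R) (measurable_itv `]0, L[).

Definition L2 (L : R) := LspaceType2 (lebesgue0 L).

Lemma lebesgue0_lty (L : R) (A : set (measurableTypeR R)) : measurable A ->
  (lebesgue0 L A < +oo)%E.
Proof.
move=> mA; rewrite /lebesgue0 /= /mrestr.
have mI : measurable (`]0, L[%classic : set (measurableTypeR R)) by [].
apply: (@le_lt_trans _ _ (lebesgue_measure `]0%R, L[%classic)).
  by apply: le_measure; rewrite ?inE//; exact: measurableI.
by rewrite lebesgue_measure_itv/=; case: ifP => _; rewrite -?EFinB ltry.
Qed.

Lemma indic_itv_Lfun2 (L : R) (i : interval R) :
  (\1_[set` i] : measurableTypeR R -> R) \in Lfun (lebesgue0 L) 2.
Proof.
have mi : measurable ([set` i] : set (measurableTypeR R)).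
  exact: measurable_itv.
exact: indic_Lfun2 mi (lebesgue0_lty L mi).
Qed.

Definition L2_indic (L : R) (i : interval R) : L2 L :=
  Lclass (Lfun_Sub _ (indic_itv_Lfun2 L i)).

Variant boundary_condition := Dirichlet | Neumann.

Definition satisfies_bc (bc : boundary_condition) (L : R) (f : R -> R) : Prop :=
  let g := if bc is Dirichlet then f else derive1 f in
  g x @[x --> 0^'+] --> 0 /\ g x @[x --> L^'-] --> 0.

(* F lies in the domain of the Laplacian and - Delta F = G. The first three
   clauses say that F belongs to H^2(0, L) with - F'' = G: its C^1
   representative f has an absolutely continuous derivative with f'' = - G
   a.e.; the traces of f and f' at 0 and L are then one-sided limits. *)
Definition neg_laplacian (bc : boundary_condition) (L : R) (F G : L2 L) : Prop :=
  exists f : R -> R,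
    [/\ F = f %[ae lebesgue0 L],
        forall x, 0 < x < L -> derivable f x 1,
        forall x y, 0 < x -> x <= y -> y < L ->
          derive1 f x - derive1 f y = \int[lebesgue_measure]_(z in `[x, y]) G z
      & satisfies_bc bc L f].

Definition eigenfunction (bc : boundary_condition) (L lam : R) (F : L2 L) : Prop :=
  F != 0 /\ neg_laplacian bc F (lam *: F).

(* phi i is the (i+1)-th eigenfunction, for the (i+1)-th smallest eigenvalue
   lam i; the inequality is strict because all eigenvalues are simple. *)
Definition eigenfunction_sequence (bc : boundary_condition) (L : R)
    (lam : nat -> R) (phi : nat -> L2 L) : Prop :=
  [/\ forall i, eigenfunction bc (lam i) (phi i),
      forall i j, (i < j)%N -> lam i < lam j
    & forall l (F : L2 L), eigenfunction bc l F -> exists i, l = lam i].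

Definition centered_itv (c h : R) : interval R := `]c - h, c + h[.

End interval.

(* Main.v *)
Require Import Defs.
From mathcomp Require Import all_boot all_order all_algebra.
From mathcomp Require Import all_classical all_reals all_analysis.
From mathcomp Require Import measurable_realfun ring lra.

Import Order.TTheory GRing.Theory Num.Theory.
Import numFieldNormedType.Exports.

Local Open Scope classical_set_scope.
Local Open Scope ring_scope.

(** Take the centers at the midpoints of the uniform partition of [(0, L)] into
    [M] cells.  Averaging an eigenfunction [sin (w x)] or [cos (w x)] over an
    interval of half-width [h] multiplies its value at the center by a factor
    [s] that does not depend on the center, so the Gram matrix between the
    indicators and the first [M] eigenfunctions is [diag(s_i) S], where [S]
    samples the eigenfunctions at the midpoints.  The rows of [S] are orthogonal
    with squared norm at least [M / 2] (discrete sine and cosine transforms of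
    type II), and [w_i h <= pi r / 2] gives [s_i >= 2 h cos (pi r / 2)].
    Inverting the Gram matrix explicitly and applying Bessel's inequality bounds
    the projection uniformly in [M]. *)

(** * Oblique projections along biorthogonal families *)

(** The sequence [phi] is known only through its eigenvalue problem, in integrated form and up to
    equality almost everywhere, so the sines and cosines have to be recovered from it: the equation
    y'' = - l y is solved on the open interval, the boundary conditions quantize l, and strict
    ordering of the eigenvalues matches the indices. Each [phi i] is then a nonzero multiple of a
    model eigenfunction, which leaves the spans unchanged.

    Uniformity in [M] is a balance of scales. With m_i and n_i the squared norms of the i-th
    eigenfunction and of the i-th row of [S], the projection costs 2 h m_i / (s_i^2 n_i) in mode i.
    Here h is of order 1 / M, s_i of order h, n_i of order M, and m_i lies between L / 2 and L, so
    the powers of [M] cancel mode by mode. The crude inequality sin y >= y cos y suffices for s_i,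
    because r < 1 keeps w_i h below pi / 2 uniformly in i and [M]. *)

Lemma direct_sumP (R : realType) (V : lmodType R) (F E : set V) :
  (forall x y, F x -> F y -> E (x - y) -> x = y) ->
  (forall x y, E x -> E y -> E (x - y)) ->
  (forall x, exists2 y, F y & E (x - y)) -> direct_sum F E.
Proof.
move=> FE0 EB FE x; have [y Fy Ey] := FE x; exists (y, x - y).
split=> [|[y' z'] /= [Fy' Ez' xE]]; first by split=> //=; rewrite addrC subrK.
have {}Ez' : E (x - y') by rewrite xE addrC addKr.
have -> : z' = x - y' by rewrite xE addrC addKr.
suff -> : y = y' by [].
apply: FE0 => //; have -> : y - y' = (x - y') - (x - y).
  by rewrite opprB [RHS]addrC addrA subrK.
exact: EB.
Qed.

Lemma oblique_projE (R : realType) (V : lmodType R) (F E : set V) (x y : V) :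
  direct_sum F E -> F y -> E (x - y) -> oblique_proj F E x = y.
Proof.
move=> FE Fy Ey; apply: xget_unique => [//|y' [Fy' Ey']].
have [z [_ z_uniq]] := FE x.
have zE w : F w -> E (x - w) -> z = (w, x - w).
  by move=> Fw Ew; apply: z_uniq; split=> //=; rewrite addrC subrK.
by have := zE _ Fy Ey; rewrite (zE _ Fy' Ey') => -[].
Qed.

Section oblique_projection_bound.
Context (R : realType) (V : lmodType R) (ip : V -> V -> R).
Hypothesis ip_linear : forall z, linear_for *%R (ip^~ z).
Hypothesis ipC : forall x y, ip x y = ip y x.
Hypothesis ip_ge0 : forall x, 0 <= ip x x.
(** [psi] stands for the eigenfunctions and [u] for the indicators. [m], [n] and [h] are the squared
    norms of the [psi i], of the rows of [S] and of the [u j], so [h] is here the full length of an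
    interval; [s] holds the averaging factors and [S] the samples at the centers. *)
Context (M : nat) (psi u : 'I_M -> V) (m n s : 'I_M -> R) (h : R) (S : 'M[R]_M).
Hypothesis psi_orth : forall i k, ip (psi i) (psi k) = m i *+ (i == k).
Hypothesis u_orth : forall j k, ip (u j) (u k) = h *+ (j == k).
Hypothesis u_psi : forall j i, ip (u j) (psi i) = s i * S i j.
Hypothesis S_orth : forall i k, \sum_j S i j * S k j = n i *+ (i == k).
Hypothesis m_gt0 : forall i, 0 < m i.
Hypothesis n_gt0 : forall i, 0 < n i.
Hypothesis s_gt0 : forall i, 0 < s i.

Let U := lin_span u.
Let P := [set x | forall y, lin_span psi y -> ip x y = 0].

Let ipD x y z : ip (x + y) z = ip x z + ip y z.
Proof. by have := ip_linear z 1 x y; rewrite scale1r mul1r. Qed.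

Let ip0 z : ip 0 z = 0.
Proof. by apply: (addIr (ip 0 z)); rewrite -ipD !add0r. Qed.

Let ipZ a x z : ip (a *: x) z = a * ip x z.
Proof. by have := ip_linear z a x 0; rewrite ip0 !addr0. Qed.

Let ipB x y z : ip (x - y) z = ip x z - ip y z.
Proof. by rewrite ipD -scaleN1r ipZ mulN1r. Qed.

Let ip_suml (a : 'I_M -> R) (v : 'I_M -> V) z :
  ip (\sum_i a i *: v i) z = \sum_i a i * ip (v i) z.
Proof.
rewrite (big_morph (ip^~ z) (fun x y => ipD x y z) (ip0 z)).
by apply: eq_bigr => i _; rewrite ipZ.
Qed.

Let orthP x : P x <-> forall i, ip x (psi i) = 0.
Proof.
split=> [Px i|x0 _ [a _ <-]]; last first.
  by rewrite ipC ip_suml big1// => i _; rewrite ipC x0 mulr0.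
apply: Px; exists (fun k => (k == i)%:R) => //.
rewrite (bigD1 i)//= eqxx scale1r big1 ?addr0// => k /negbTE->.
by rewrite scale0r.
Qed.

(** Orthogonal nonzero rows give [S] the right inverse [S^T *m Dv]; as [S] is square, this is also a
    left inverse, and that is the side on which [a] cancels. *)
Let S_inj (a : 'I_M -> R) : (forall i, \sum_j a j * S i j = 0) -> a =1 fun=> 0.
Proof.
move=> a0; pose Dv := diag_mx (\row_i (n i)^-1) : 'M[R]_M.
have SSD : S *m (S^T *m Dv) = 1%:M.
  rewrite mulmxA; apply/matrixP => i k; rewrite mul_mx_diag !mxE.
  under eq_bigr do rewrite mxE.
  rewrite S_orth; case: eqVneq => [->|_]; last by rewrite mul0r.
  by rewrite mulr1n divff// gt_eqF.
have SDS := mulmx1C SSD; rewrite -mulmxA in SDS.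
pose av := \row_j a j : 'rV[R]_M.
have av0 : av *m S^T = 0.
  apply/rowP => i; rewrite !mxE -[RHS](a0 i).
  by apply: eq_bigr => j _; rewrite !mxE.
have : av = 0 by rewrite -[av]mulmx1 -SDS (mulmxA av) av0 mul0mx.
by move=> /rowP aE j; have := aE j; rewrite !mxE.
Qed.

(** The Gram matrix is diag(s) S, and the inverse of S is S^T diag(1/n), so these are the
    coefficients for which [proj x] and [x] have the same products with all the [psi i]. *)
Let coef x j := \sum_i ip x (psi i) / (s i * n i) * S i j.
Let proj x := \sum_j coef x j *: u j.

Let proj_psi x k : ip (proj x) (psi k) = ip x (psi k).
Proof.
rewrite ip_suml.
transitivity (\sum_i ip x (psi i) / (s i * n i) * s k * \sum_j S i j * S k j).
  under eq_bigr do rewrite u_psi /coef mulr_suml.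
  rewrite exchange_big/=; apply: eq_bigr => i _.
  by rewrite mulr_sumr; apply: eq_bigr => j _; rewrite mulrACA !mulrA.
under eq_bigr do rewrite S_orth.
rewrite (bigD1 k)//= eqxx big1 ?addr0; last first.
  by move=> i /negbTE->; rewrite mulr0.
rewrite -mulrA -[LHS]mulrA mulVf ?mulr1// mulf_neq0// gt_eqF//.
Qed.

Let uP x : U x -> exists a : 'I_M -> R, x = \sum_j a j *: u j.
Proof. by case=> a _ <-; exists a. Qed.

Lemma direct_sum_biorthogonal : direct_sum U P.
Proof.
apply: direct_sumP => [x y /uP[a ->] /uP[b ->] /orthP ab|x y /orthP x0 /orthP y0|x].
- suff ab0 : (fun j => a j - b j) =1 fun=> 0.
    by apply: eq_bigr => j _; congr (_ *: _); apply/eqP; rewrite -subr_eq0 ab0.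
  apply: S_inj => i; apply: (mulfI (lt0r_neq0 (s_gt0 i))).
  rewrite mulr0 -[RHS](ab i) ipB !ip_suml -sumrB mulr_sumr.
  by apply: eq_bigr => j _; rewrite u_psi -mulrBl mulrCA.
- by apply/orthP => i; rewrite ipB x0 y0 subrr.
- exists (proj x); first by exists (coef x).
  by apply/orthP => i; rewrite ipB proj_psi subrr.
Qed.

(** Positivity of [ip] at [x - y], where [y] is the orthogonal projection onto the span of the
    [psi i]; these are orthogonal but not normalized, hence the division by [m i]. *)
Let bessel x : \sum_i ip x (psi i) ^+ 2 / m i <= ip x x.
Proof.
pose y := \sum_i (ip x (psi i) / m i) *: psi i.
have yx : ip y x = \sum_i ip x (psi i) ^+ 2 / m i.
  by rewrite ip_suml; apply: eq_bigr => i _; rewrite (ipC (psi i)) mulrAC expr2.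
have yy : ip y y = ip y x.
  rewrite !ip_suml; apply: eq_bigr => i _; congr (_ * _).
  rewrite ipC ip_suml (bigD1 i)//= psi_orth eqxx mulr1n divfK ?gt_eqF//.
  rewrite big1 ?addr0; first by rewrite ipC.
  by move=> k /negbTE ki; rewrite psi_orth ki mulr0.
have := ip_ge0 (x - y); rewrite ipB !(ipC _ (x - y)) !ipB yy (ipC x y) subrr subr0.
by rewrite subr_ge0 yx.
Qed.

(** Orthogonality of the [u j] gives the squared norm of [proj x] as [h] times the sum of the
    squared coefficients. Expanding these and summing over [j] first, orthogonality of the rows of
    [S] removes all cross terms. What remains is a sum over modes with weights h / (s_i^2 n_i), and
    [hC] compares them one by one with the weights 1 / m_i of Bessel's inequality. *)
Lemma oblique_proj_le (C : R) x : 0 <= C ->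
  (forall i, h * m i <= C * (s i ^+ 2 * n i)) ->
  ip (oblique_proj U P x) (oblique_proj U P x) <= C * ip x x.
Proof.
move=> C0 hC; have sn i : 0 < s i ^+ 2 * n i by rewrite mulr_gt0 ?exprn_gt0.
have -> : oblique_proj U P x = proj x.
  apply: oblique_projE; [exact: direct_sum_biorthogonal|by exists (coef x)|].
  by apply/orthP => i; rewrite ipB proj_psi subrr.
have -> : ip (proj x) (proj x) = \sum_i ip x (psi i) ^+ 2 * (h / (s i ^+ 2 * n i)).
  transitivity (h * \sum_j coef x j ^+ 2).
    rewrite [LHS]ip_suml mulr_sumr; apply: eq_bigr => j _.
    rewrite ipC ip_suml (bigD1 j)//= u_orth eqxx big1 ?addr0; last first.
      by move=> k /negbTE kj; rewrite u_orth kj mulr0.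
    by rewrite mulr1n mulrA -expr2 mulrC.
  pose b i := ip x (psi i) / (s i * n i).
  transitivity (h * \sum_i \sum_k b i * b k * \sum_j S i j * S k j).
    congr (_ * _); under eq_bigr do rewrite expr2 /coef big_distrlr/=.
    rewrite exchange_big/=; apply: eq_bigr => i _.
    rewrite exchange_big/=; apply: eq_bigr => k _.
    by rewrite mulr_sumr; apply: eq_bigr => j _; rewrite mulrACA.
  rewrite mulr_sumr; apply: eq_bigr => i _.
  rewrite (bigD1 i)//= S_orth eqxx big1 ?addr0; last first.
    by move=> k; rewrite eq_sym => /negbTE ki; rewrite S_orth ki mulr0.
  have s0 := lt0r_neq0 (s_gt0 i); have n0 := lt0r_neq0 (n_gt0 i).
  by rewrite /b mulr1n; field; rewrite s0 n0.
apply: (@le_trans _ _ (\sum_i C * (ip x (psi i) ^+ 2 / m i))).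
  apply: ler_sum => i _; rewrite [leRHS]mulrCA ler_wpM2l ?sqr_ge0//.
  by rewrite ler_pdivlMr// mulrAC ler_pdivrMr// hC.
by rewrite -mulr_sumr ler_wpM2l ?bessel.
Qed.

End oblique_projection_bound.

(** * The model eigenfunctions *)

Section trigonometry.
Context {R : realType}.
Implicit Types (x y t : R) (k : nat).

Lemma sin_mulr_natpi k : sin (k%:R * pi) = 0 :> R.
Proof.
elim: k => [|k IH]; first by rewrite mul0r sin0.
by rewrite -natr1 mulrDl mul1r sinDpi IH oppr0.
Qed.

Lemma cos_mulr_natpi k : cos (k%:R * pi) = (-1) ^+ k :> R.
Proof.
elim: k => [|k IH]; first by rewrite mul0r cos0.
by rewrite -natr1 mulrDl mul1r cosDpi IH exprS mulN1r.
Qed.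

Lemma sin_addr_natpi x k : sin (x + k%:R * pi) = (-1) ^+ k * sin x.
Proof. by rewrite sinD sin_mulr_natpi cos_mulr_natpi mulr0 addr0 mulrC. Qed.

(** With k the integer part of x / pi, the remainder x - k pi lies in [0, pi), where sine vanishes
    only at 0; the shift by k pi affects the sign alone. *)
Lemma sin_eq0_natpi x : 0 <= x -> sin x = 0 -> exists k, x = k%:R * pi.
Proof.
move=> x0 sx; have pi0 : 0 < pi :> R := pi_gt0 R.
have /andP[kx xk] := truncn_itv (divr_ge0 x0 (ltW pi0)).
move: kx xk; set k := Num.trunc _; rewrite ler_pdivlMr// ltr_pdivrMr// => kx xk.
exists k; apply/eqP; rewrite -subr_eq0; apply: contraTT isT => y0 /=.
have : 0 < sin (x - k%:R * pi).
  apply: sin_gt0_pi; rewrite lt_neqAle eq_sym y0 subr_ge0 kx /=.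
  by rewrite ltrBlDr -{1}[pi]mul1r -mulrDl nat1r.
have := sin_addr_natpi (x - k%:R * pi) k; rewrite subrK sx => /esym/eqP.
by rewrite mulf_eq0 signr_eq0 /= => /eqP->; rewrite ltxx.
Qed.

(** By the mean value theorem sin y = y cos t for some t between 0 and y, and cosine decreases
    there. *)
Lemma sin_ge_mulcos y : 0 <= y <= pi / 2 -> y * cos y <= sin y.
Proof.
move=> /andP[y0 ypi]; rewrite le_eqVlt in y0.
case/predU1P: y0 => [<-|y0]; first by rewrite mul0r sin0.
have [|t ty] := @MVT R sin cos 0 y y0 (fun t _ => is_derive_sin t).
  by apply: continuous_subspaceT => t; exact: continuous_sin.
rewrite sin0 !subr0 => ->; rewrite mulrC ler_wpM2r ?(ltW y0)//.
have pi1 : pi / 2 <= pi :> R by rewrite ler_pdivrMr// ler_peMr ?pi_ge0// ler1n.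
move: ty; rewrite in_itv/= => /andP[t0 ty].
rewrite leNgt ltr_cos ?in_itv/= -?leNgt ?(ltW ty)//; last 2 first.
- by rewrite (ltW y0) (le_trans ypi).
- by rewrite (ltW t0) (le_trans (ltW ty))// (le_trans ypi).
Qed.

(** Telescoping: 2 sin t cos ((2 j + 1) t) = sin (2 (j + 1) t) - sin (2 j t). *)
Lemma sum_cos_arith t n :
  2 * sin t * \sum_(j < n) cos (t * (2 * j%:R + 1)) = sin (2 * n%:R * t).
Proof.
elim: n => [|n IH]; first by rewrite big_ord0 !(mulr0, mul0r) sin0.
rewrite big_ord_recr/= mulrDr IH.
have -> : 2 * n.+1%:R * t = t * (2 * n%:R + 1) + t by rewrite -natr1; ring.
have -> : 2 * n%:R * t = t * (2 * n%:R + 1) - t by ring.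
by rewrite sinB sinD; ring.
Qed.

(** For 0 < k < 2 n, put t = k pi / (2 n): the telescoped sum is sin (k pi) = 0 and sin t is
    nonzero. At k = 2 n every term is the cosine of an odd multiple of pi; this aliased case occurs
    for the square of the highest Dirichlet mode. *)
Lemma sum_cos_midpoints n k : (0 < n)%N -> (k <= 2 * n)%N ->
  \sum_(j < n) cos (k%:R * (2 * j%:R + 1) * pi / (2 * n%:R)) =
  if k == 0%N then n%:R else if k == (2 * n)%N then - n%:R else 0 :> R.
Proof.
move=> n0 kn; have nR0 : n%:R != 0 :> R by rewrite pnatr_eq0 -lt0n.
have [->|k0] := eqVneq k 0%N.
  under eq_bigr do rewrite !mul0r cos0.
  by rewrite big_const_ord iter_addr_0.
have [->|k2n] := eqVneq k (2 * n)%N.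
  rewrite -mulNrn -[in RHS](card_ord n) -sumr_const; apply: eq_bigr => j _.
  have -> : (2 * n)%:R * (2 * j%:R + 1) * pi / (2 * n%:R) = (2 * j + 1)%:R * pi :> R.
    by rewrite natrM natrD natrM; field.
  by rewrite cos_mulr_natpi addn1 exprS exprM sqrrN expr1n expr1n mulr1.
pose t : R := k%:R * pi / (2 * n%:R).
have st0 : 2 * sin t != 0.
  rewrite mulf_neq0// gt_eqF//; apply: sin_gt0_pi; apply/andP; split.
    by apply: divr_gt0; rewrite mulr_gt0 ?pi_gt0 ?ltr0n ?(lt0n k).
  rewrite ltr_pdivrMr ?mulr_gt0 ?ltr0n// mulrC ltr_pM2l ?pi_gt0//.
  by rewrite -natrM ltr_nat ltn_neqAle k2n.
apply: (mulfI st0); rewrite mulr0.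
transitivity (2 * sin t * \sum_(j < n) cos (t * (2 * j%:R + 1))).
  by congr (_ * _); apply: eq_bigr => j _; congr cos; rewrite /t; ring.
rewrite sum_cos_arith (_ : 2 * n%:R * t = k%:R * pi) ?sin_mulr_natpi//.
by rewrite /t; field.
Qed.

End trigonometry.

(** * Wave numbers and discrete orthogonality at the midpoints *)

Section model_eigenfunctions.
Context {R : realType}.
Implicit Types (bc : boundary_condition) (L x y w : R) (i k M : nat).

Definition trig_of_bc bc : R -> R := if bc is Dirichlet then sin else cos.

(* Indices start at 0, whereas the Dirichlet wave numbers start at 1. *)
Definition wave_number bc i : nat := if bc is Dirichlet then i.+1 else i.

Definition frequency bc L i : R := (wave_number bc i)%:R * (pi / L).

Definition model_eigenfun bc L i x : R := trig_of_bc bc (frequency bc L i * x).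

(** The sign in the product-to-sum formula, through which both boundary conditions share all
    orthogonality computations. *)
Definition bc_sign bc : R := if bc is Dirichlet then -1 else 1.

Lemma trig_mul bc x y :
  trig_of_bc bc x * trig_of_bc bc y = (cos (y - x) + bc_sign bc * cos (y + x)) / 2.
Proof. by case: bc; rewrite /= cosB cosD; field. Qed.

Lemma frequency_ge0 bc L i : 0 < L -> 0 <= frequency bc L i.
Proof. by move=> L0; rewrite mulr_ge0// divr_ge0 ?pi_ge0 ?ltW. Qed.

Lemma wave_number_lt bc i k : (i < k)%N -> (wave_number bc i < wave_number bc k)%N.
Proof. by case: bc. Qed.

Lemma wave_number_add_le bc i k M : (i < M)%N -> (k < M)%N ->
  (wave_number bc i + wave_number bc k <= 2 * M)%N.
Proof. by case: bc => /= iM kM; rewrite mul2n -addnn leq_add// ltnW. Qed.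

Lemma model_eigenfun_mul bc L i k x : (i <= k)%N ->
  model_eigenfun bc L i x * model_eigenfun bc L k x =
  (cos ((wave_number bc k - wave_number bc i)%:R * (pi / L) * x) +
   bc_sign bc * cos ((wave_number bc k + wave_number bc i)%:R * (pi / L) * x)) / 2.
Proof.
move=> ik; rewrite /model_eigenfun trig_mul /frequency -mulrBl -mulrDl -mulrBl -mulrDl.
by rewrite natrB ?natrD//; move: ik; case: bc.
Qed.

Definition midpoint L M j : R := (2 * j%:R + 1) * L / (2 * M%:R).

(** The product-to-sum formula leaves two cosine sums, at the difference and at the sum of the wave
    numbers; [i <= k] makes the difference a genuine natural number. The sum of the wave numbers is
    0 only for the constant Neumann mode squared, and 2 M only for the highest Dirichlet mode
    squared. *)
Lemma sum_model_eigenfun_mul bc L M i k : L != 0 -> (i <= k)%N -> (k < M)%N ->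
  \sum_(j < M) model_eigenfun bc L i (midpoint L M j) *
               model_eigenfun bc L k (midpoint L M j) =
  ((if k == i then M%:R else 0) +
   bc_sign bc * (if (wave_number bc k + wave_number bc i == 0)%N then M%:R else
     if (wave_number bc k + wave_number bc i == 2 * M)%N then - M%:R else 0)) / 2.
Proof.
move=> L0 ik kM; have M0 : (0 < M)%N by case: M kM.
have MR0 : M%:R != 0 :> R by rewrite pnatr_eq0 -lt0n.
under eq_bigr do rewrite model_eigenfun_mul//.
rewrite -mulr_suml big_split/= -mulr_sumr; congr ((_ + _ * _) / 2).
- transitivity (\sum_(j < M) cos ((wave_number bc k - wave_number bc i)%:R *
      (2 * j%:R + 1) * pi / (2 * M%:R)) : R).
    by apply: eq_bigr => j _; congr cos; rewrite /midpoint; field; rewrite L0 MR0.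
  have iM := leq_ltn_trans ik kM.
  rewrite sum_cos_midpoints//; last first.
    rewrite (leq_trans (leq_subr _ _))// (leq_trans (leq_addr (wave_number bc i) _))//.
    exact: wave_number_add_le.
  have -> : (wave_number bc k - wave_number bc i = k - i)%N by case: bc => //=.
  rewrite subn_eq0 (eqn_leq k i) ik andbT; case: ifP => // _.
  by rewrite ltn_eqF// (leq_ltn_trans (leq_subr _ _))// mul2n -addnn ltn_addr.
- transitivity (\sum_(j < M) cos ((wave_number bc k + wave_number bc i)%:R *
      (2 * j%:R + 1) * pi / (2 * M%:R)) : R).
    by apply: eq_bigr => j _; congr cos; rewrite /midpoint; field; rewrite L0 MR0.
  by rewrite sum_cos_midpoints// wave_number_add_le// (leq_ltn_trans ik).
Qed.

Lemma model_eigenfun_grid_orth bc L M (i k : 'I_M) : L != 0 -> i != k ->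
  \sum_(j < M) model_eigenfun bc L i (midpoint L M j) *
               model_eigenfun bc L k (midpoint L M j) = 0.
Proof.
move=> L0; wlog ik : i k / (i < k)%N => [H ik|_].
  have [/H->//|ki|/val_inj ki] := ltngtP i k; last by rewrite ki eqxx in ik.
  by rewrite -[RHS](H k i ki) 1?eq_sym//; apply: eq_bigr => j _; rewrite mulrC.
rewrite sum_model_eigenfun_mul ?(ltnW ik)// (gtn_eqF ik).
have q0 : (wave_number bc k + wave_number bc i == 0)%N = false.
  by rewrite gtn_eqF// ltn_addr// (leq_ltn_trans _ (wave_number_lt bc _ _ ik)).
rewrite q0 ltn_eqF ?(mulr0, add0r, mul0r)//.
have := wave_number_add_le bc _ _ _ (ltn_ord k) (ltn_ord k).
by apply: leq_trans; rewrite -addnS leq_add2l wave_number_lt.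
Qed.

(** Both exceptional cases help: for the constant Neumann mode the extra term is M, and for the
    highest Dirichlet mode the aliased value - M meets the sign -1. The squared norm is thus M / 2
    or M. *)
Lemma model_eigenfun_grid_norm bc L M (i : 'I_M) : L != 0 ->
  M%:R / 2 <= \sum_(j < M) model_eigenfun bc L i (midpoint L M j) *
                           model_eigenfun bc L i (midpoint L M j).
Proof.
move=> L0; rewrite sum_model_eigenfun_mul// eqxx ler_wpM2r// lerDl.
case: bc => /=; first by rewrite mulN1r oppr_ge0; case: ifP; rewrite ?oppr_le0 ?lexx.
rewrite mul1r; case: ifP => // _; rewrite ltn_eqF//.
by rewrite mul2n addnn ltn_double.
Qed.

End model_eigenfunctions.

(** * Integrals over (0, L) and averages over centered intervals *)

Section integrals_of_model_eigenfunctions.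
Context {R : realType}.
Implicit Types (bc : boundary_condition) (L x y w c h : R) (i k M : nat).

Lemma is_derive_mull w x : is_derive x 1 ( *%R w) w.
Proof.
have := is_deriveZ w (is_derive_id x (1 : R)).
by rewrite /GRing.scale/= mulr1.
Qed.

Lemma is_derive_sin_mull w x :
  is_derive x 1 (fun y => sin (w * y)) (w * cos (w * x)).
Proof.
rewrite mulrC.
exact: (is_derive1_comp (is_derive_sin (w * x)) (is_derive_mull w x)).
Qed.

Lemma is_derive_cos_mull w x :
  is_derive x 1 (fun y => cos (w * y)) (- (w * sin (w * x))).
Proof.
rewrite mulrC -mulNr.
exact: (is_derive1_comp (is_derive_cos (w * x)) (is_derive_mull w x)).
Qed.

Lemma is_derive_continuous {f : R -> R} {df x : R} :
  is_derive x 1 f df -> {for x, continuous f}.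
Proof. by move=> [fx _]; exact/differentiable_continuous/derivable1_diffP. Qed.

Lemma continuous_model_eigenfun bc L i : continuous (model_eigenfun bc L i).
Proof.
move=> x; case: bc.
  exact: (is_derive_continuous (is_derive_sin_mull (frequency _ L i) x)).
exact: (is_derive_continuous (is_derive_cos_mull (frequency _ L i) x)).
Qed.

Lemma Rintegral_FTC2 (f F : R -> R) a b : a < b ->
  continuous f -> (forall x, is_derive x 1 F (f x)) ->
  \int[lebesgue_measure]_(x in `[a, b]) f x = F b - F a.
Proof.
move=> ab cf dF; have cF : continuous F by move=> x; exact: is_derive_continuous (dF x).
rewrite /Rintegral (@continuous_FTC2 _ f F)//.
- exact: continuous_subspaceT.
- split.
  + by move=> x _; have [] := dF x.
  + exact: cvg_at_right_filter (cF a).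
  + exact: cvg_at_left_filter (cF b).
- by move=> x _; rewrite derive1E; have [] := dF x.
Qed.

Lemma integral_cos L k : 0 < L ->
  \int[lebesgue_measure]_(x in `[0, L]) cos (k%:R * (pi / L) * x) =
  if k == 0%N then L else 0.
Proof.
move=> L0; have pi0 := lt0r_neq0 (pi_gt0 R); have LN0 := lt0r_neq0 L0.
have cc : continuous (fun x => cos (k%:R * (pi / L) * x)).
  by move=> x; exact: is_derive_continuous (is_derive_cos_mull _ x).
case: eqVneq cc => [->|k0] cc.
  have dF x : is_derive x 1 id (cos (0%:R * (pi / L) * x)).
    by rewrite !mul0r cos0; exact: is_derive_id.
  by rewrite (Rintegral_FTC2 _ _ _ _ L0 cc dF) subr0.
have w0 : k%:R * (pi / L) != 0 by rewrite !mulf_neq0 ?invr_eq0 ?pnatr_eq0.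
have dF x : is_derive x 1 (fun x => (k%:R * (pi / L))^-1 * sin (k%:R * (pi / L) * x))
    (cos (k%:R * (pi / L) * x)).
  have := is_deriveZ (k%:R * (pi / L))^-1 (is_derive_sin_mull (k%:R * (pi / L)) x).
  by rewrite /GRing.scale/= mulKf.
rewrite (Rintegral_FTC2 _ _ _ _ L0 cc dF).
rewrite mulr0 sin0 mulr0 subr0 (_ : _ * L = k%:R * pi) ?sin_mulr_natpi ?mulr0//.
by field.
Qed.

Lemma continuous_itv_integrable (f : R -> R) a b : continuous f ->
  (@lebesgue_measure R).-integrable `[a, b] (EFin \o f).
Proof.
move=> cf; apply: continuous_compact_integrable; first exact: segment_compact.
exact: continuous_subspaceT.
Qed.

(** The continuous counterpart of [sum_model_eigenfun_mul]: there is no aliasing, so the constant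
    Neumann mode is the only exception. *)
Lemma integral_model_eigenfun_mul bc L i k : 0 < L -> (i <= k)%N ->
  \int[lebesgue_measure]_(x in `[0, L])
     (model_eigenfun bc L i x * model_eigenfun bc L k x) =
  ((if k == i then L else 0) +
   bc_sign bc * (if (wave_number bc k + wave_number bc i == 0)%N then L else 0)) / 2.
Proof.
move=> L0 ik.
have cc n : continuous (fun x => cos (n%:R * (pi / L) * x)).
  by move=> x; exact: is_derive_continuous (is_derive_cos_mull _ x).
under eq_Rintegral do rewrite model_eigenfun_mul// mulrC.
rewrite RintegralZl//; last first.
  apply: continuous_itv_integrable => x; apply: cvgD; first exact: cc.
  by apply: cvgM; [exact: cvg_cst|exact: cc].
rewrite RintegralD//; last 2 first.
- exact/continuous_itv_integrable/cc.
- apply: continuous_itv_integrable => x.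
  by apply: cvgM; [exact: cvg_cst|exact: cc].
rewrite RintegralZl//; last exact/continuous_itv_integrable/cc.
rewrite !integral_cos// mulrC; congr ((_ + _) / 2).
have -> : (wave_number bc k - wave_number bc i = k - i)%N by case: bc.
by rewrite subn_eq0 (eqn_leq k i) ik andbT.
Qed.

Lemma integral_model_eigenfun_orth bc L i k : 0 < L -> i != k ->
  \int[lebesgue_measure]_(x in `[0, L])
     (model_eigenfun bc L i x * model_eigenfun bc L k x) = 0.
Proof.
move=> L0; wlog ik : i k / (i < k)%N => [H ik|_].
  have [/H->//|ki|ki] := ltngtP i k; last by rewrite ki eqxx in ik.
  by rewrite -[RHS](H k i ki) 1?eq_sym//; apply: eq_Rintegral => x _; rewrite mulrC.
rewrite integral_model_eigenfun_mul ?(ltnW ik)// (gtn_eqF ik) gtn_eqF ?(mulr0, add0r, mul0r)//.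
by rewrite ltn_addr// (leq_ltn_trans _ (wave_number_lt bc _ _ ik)).
Qed.

Lemma integral_model_eigenfun_norm bc L i : 0 < L ->
  L / 2 <= \int[lebesgue_measure]_(x in `[0, L])
     (model_eigenfun bc L i x * model_eigenfun bc L i x) <= L.
Proof.
move=> L0; rewrite integral_model_eigenfun_mul// eqxx.
case: bc => /=.
  by rewrite ?addSn ?addnS /= mulr0 addr0 lexx ler_pdivrMr// ler_peMr ?ler1n// ltW.
by rewrite mul1r; case: ifP => _; apply/andP; split; lra.
Qed.

(** This is 2 h sinc (w h), with its limit at w = 0 as needed by the constant Neumann mode. *)
Definition averaging_factor w h : R := if w == 0 then 2 * h else 2 * sin (w * h) / w.

Lemma integral_trig_centered bc w c h : 0 < h ->
  \int[lebesgue_measure]_(x in `[c - h, c + h]) trig_of_bc bc (w * x) =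
  averaging_factor w h * trig_of_bc bc (w * c).
Proof.
move=> h0; have chch : c - h < c + h by rewrite ltrD2l gtrN.
rewrite /averaging_factor; case: eqVneq => [->|w0].
  under eq_Rintegral do rewrite mul0r.
  have dF x : is_derive x 1 ( *%R (trig_of_bc bc 0)) (trig_of_bc bc 0).
    exact: is_derive_mull.
  rewrite (Rintegral_FTC2 _ _ _ _ chch (fun x => cvg_cst _) dF) mul0r; ring.
case: bc => /=.
- have dF x : is_derive x 1 (fun x => - w^-1 * cos (w * x)) (sin (w * x)).
    have := is_deriveZ (- w^-1) (is_derive_cos_mull w x).
    by rewrite /GRing.scale/= mulrNN mulKf.
  have cf x := is_derive_continuous (is_derive_sin_mull w x).
  by rewrite (Rintegral_FTC2 _ _ _ _ chch cf dF) mulrDr mulrBr cosD cosB; field.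
- have dF x : is_derive x 1 (fun x => w^-1 * sin (w * x)) (cos (w * x)).
    have := is_deriveZ w^-1 (is_derive_sin_mull w x).
    by rewrite /GRing.scale/= mulKf.
  have cf x := is_derive_continuous (is_derive_cos_mull w x).
  by rewrite (Rintegral_FTC2 _ _ _ _ chch cf dF) mulrDr mulrBr sinD sinB; field.
Qed.

(** [sin_ge_mulcos] at w h bounds the factor below by 2 h cos (w h), and cosine decreases on
    [0, pi]. The point is that the result depends on the mode only through the common bound [t]. *)
Lemma averaging_factor_ge w h t : 0 <= w -> 0 < h -> w * h <= t <= pi / 2 ->
  2 * h * cos t <= averaging_factor w h.
Proof.
move=> w0 h0 /andP[wht tpi]; rewrite /averaging_factor.
case: eqVneq => [_|wN0]; first by rewrite ler_piMr ?cos_le1// mulr_ge0// ltW.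
have {}w0 : 0 < w by rewrite lt_neqAle eq_sym wN0.
rewrite ler_pdivlMr// -!mulrA ler_pM2l// mulrA mulrAC (mulrC h).
have wh0 : 0 <= w * h by rewrite mulr_ge0 ?ltW.
apply: (@le_trans _ _ (w * h * cos (w * h))).
  rewrite ler_wpM2l// leNgt.
  have pi1 : pi / 2 <= pi :> R by rewrite ler_pdivrMr// ler_peMr ?pi_ge0// ler1n.
  have tpi' := le_trans tpi pi1.
  by rewrite ltr_cos ?in_itv/= -?leNgt// ?wh0 ?(le_trans wh0 wht) ?(le_trans wht tpi').
by apply: sin_ge_mulcos; rewrite wh0 (le_trans wht).
Qed.

End integrals_of_model_eigenfunctions.

(** * The inner product of L2 *)

Section L2_inner_product.
Context {d : measure_display} {T : measurableType d} {R : realType}.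
Context {mu : {measure set T -> \bar R}}.
Local Notation L2mu := (LspaceType2 mu).
Implicit Types (F G H : L2mu) (f g : T -> R).

Lemma Lspace_Lfun F : (F : T -> R) \in Lfun mu 2%:E.
Proof. exact: Lrepr_subproof. Qed.

Lemma measurable_Lspace F : measurable_fun setT (F : T -> R).
Proof. by have := Lspace_Lfun F; rewrite inE => /andP[/[!inE]]. Qed.

Lemma Lspace_scaleE (a : R) F : (a *: F : L2mu) = (fun x => a * F x) %[ae mu].
Proof. exact: Lclass_ae. Qed.

Lemma Lspace_addE F G : (F + G : L2mu) = (fun x => F x + G x) %[ae mu].
Proof. exact: Lclass_ae. Qed.

Lemma integrable_L2_mul F G : mu.-integrable setT (EFin \o (fun x => F x * G x)).
Proof.
by apply/Lfun1_integrable; exact: Lfun2_mul_Lfun1 (Lspace_Lfun F) (Lspace_Lfun G).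
Qed.

Lemma L2_inner_ae {F G} {f g} : measurable_fun setT f -> measurable_fun setT g ->
  F = f %[ae mu] -> G = g %[ae mu] -> L2_inner F G = \int[mu]_x (f x * g x).
Proof.
move=> mf mg Ff Gg; congr fine; apply: ae_eq_integral => //.
- apply/measurable_EFinP; apply: measurable_funM; exact: measurable_Lspace.
- by apply/measurable_EFinP; exact: measurable_funM.
- by move: Ff Gg; apply: filterS2 => x /(_ I) + /(_ I) + _ => /= -> ->.
Qed.

Lemma L2_innerC F G : L2_inner F G = L2_inner G F.
Proof. by apply: eq_Rintegral => x _; rewrite mulrC. Qed.

Lemma L2_inner_linear G : linear_for *%R (fun F => L2_inner F G).
Proof.
move=> a F H; have mG := measurable_Lspace G.
have aeFH : (a *: F + H : L2mu) = (fun x => a * F x + H x) %[ae mu].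
  move: (Lspace_addE (a *: F) H) (Lspace_scaleE a F).
  by apply: filterS2 => x /(_ I) + /(_ I) + _ => -> ->.
rewrite (L2_inner_ae _ mG aeFH (ae_eq_refl _ _ _)); last first.
  by apply: measurable_funD; [apply: measurable_funM|]; rewrite //; exact: measurable_Lspace.
transitivity (\int[mu]_x (a * (F x * G x) + H x * G x)).
  by apply: eq_Rintegral => x _; rewrite mulrDl mulrA.
have iFG := integrable_L2_mul F G; have iHG := integrable_L2_mul H G.
rewrite RintegralD//; first by rewrite RintegralZl.
exact: (eq_integrable measurableT _ _ _ (integrableZl measurableT a iFG)).
Qed.

Lemma L2_inner_ge0 F : 0 <= L2_inner F F.
Proof. by apply: Rintegral_ge0 => x _; rewrite -expr2 sqr_ge0. Qed.

Lemma L2_normE F : L2_norm F = (Num.sqrt (L2_inner F F))%:E.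
Proof.
have iFF : (\int[mu]_x (F x * F x)%:E)%E \is a fin_num :=
  integrable_fin_num measurableT (integrable_L2_mul F F).
rewrite /L2_norm unlock; transitivity ((\int[mu]_x (F x * F x)%:E) `^ 2^-1)%E.
  congr (_ `^ _)%E; apply: eq_integral => x _ /=.
  by rewrite powR_mulrn// -normrX ger0_norm ?sqr_ge0.
by rewrite -(fineK iFF) poweR_EFin powR12_sqrt// L2_inner_ge0.
Qed.

(** On subsets of [D] the two measures coincide, and the complement of [D] is null for the
    restricted one, so cutting [f] off outside [D] changes nothing. *)
Lemma integral_mrestr (D : set T) (mD : measurable D) (f : T -> \bar R) :
  measurable_fun setT f ->
  (\int[mrestr mu mD]_x f x = \int[mu]_(x in D) f x)%E.
Proof.
move=> mf; rewrite (@eq_measure_integral _ _ _ D (mrestr mu mD)); last first.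
  by move=> A mA AD; rewrite /= /mrestr setIidl.
rewrite [RHS]integral_mkcond; apply: ae_eq_integral => //.
  by apply/measurable_restrict => //; rewrite setTI; exact: measurable_funTS.
exists (~` D); split; first exact: measurableC.
  by rewrite /= /mrestr setICl measure0.
move=> x /= fx Dx; apply: fx => _; rewrite patchE ifT// inE//.
Qed.

End L2_inner_product.

(** * Inner products in L2(0, L) as integrals of concrete functions *)

Section L2_interval.
Context {R : realType}.
Implicit Types (bc : boundary_condition) (L x y : R) (i k M : nat).

#[global] Instance lebesgue0_ae_filter L :
  Filter (nbhs (almost_everywhere (lebesgue0 L))).
Proof. exact: (@ae_filter_ringOfSetsType _ _ _ (lebesgue0 L)). Qed.

Lemma lebesgue0_ae_eq L (f g : R -> R) :
  (forall x, 0 < x < L -> f x = g x) -> f = g %[ae lebesgue0 L].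
Proof.
move=> fg; exists (~` `]0, L[%classic); split.
- exact: measurableC.
- by rewrite /lebesgue0/= /mrestr setICl measure0.
- by move=> x /= fgx x0L; apply: fgx => _; apply: fg; rewrite in_itv/= in x0L.
Qed.

Lemma lebesgue0_Rintegral L (f : R -> R) : measurable_fun setT f ->
  \int[lebesgue0 L]_x f x = \int[lebesgue_measure]_(x in `]0, L[) f x.
Proof. by move=> mf; congr fine; apply: integral_mrestr; exact/measurable_EFinP. Qed.

(** The integral in [neg_laplacian] involves an arbitrary representative of a class; this replaces
    it by a continuous one, on closed subintervals of (0, L), where Lebesgue measure and
    [lebesgue0 L] agree. *)
Lemma lebesgue0_Rintegral_ae_itv L (f g : R -> R) x y : 0 < x -> y < L ->
  measurable_fun setT f -> {within `[x, y], continuous g} -> f = g %[ae lebesgue0 L] ->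
  \int[lebesgue_measure]_(z in `[x, y]) f z = \int[lebesgue_measure]_(z in `[x, y]) g z.
Proof.
move=> x0 yL mf cg fg; have mxy : measurable `[x, y]%classic by [].
have xyL : `[x, y] `<=` `]0, L[.
  by apply: subset_itv; rewrite bnd_simp.
have leb0E (h : R -> R) : (\int[lebesgue_measure]_(z in `[x, y]) (h z)%:E =
    \int[lebesgue0 L]_(z in `[x, y]) (h z)%:E)%E.
  apply: eq_measure_integral => A mA Axy; rewrite /lebesgue0/= /mrestr setIidl//.
  exact: subset_trans xyL.
rewrite /Rintegral !leb0E; congr fine; apply: ae_eq_integral => //.
- by apply/measurable_EFinP; exact: measurable_funTS.
- by apply/measurable_EFinP; exact: subspace_continuous_measurable_fun.
- by move: fg; apply: filterS => z /(_ I) + _ => /= ->.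
Qed.

Lemma bounded_Lfun2 L (f : R -> R) (C : R) : measurable_fun setT f ->
  (forall x, `|f x| <= C) -> f \in Lfun (lebesgue0 L) 2%:E.
Proof.
move=> mf fC; rewrite inE; apply/andP; split; rewrite inE//=.
rewrite /finite_norm unlock /Lnorm; apply: poweR_lty.
have C0 : 0 <= C := le_trans (normr_ge0 _) (fC 0).
apply: (@le_lt_trans _ _ (\int[lebesgue0 L]_x (C ^+ 2)%:E)%E).
  apply: ge0_le_integral => //.
  - by move=> x _; exact: poweR_ge0.
  - apply: (measurableT_comp (measurable_poweR _)) => //.
    by apply: measurableT_comp => //; exact/measurable_EFinP.
  - move=> x _; rewrite /= lee_fin powR_mulrn//.
    by rewrite lerXn2r ?nnegrE//.
rewrite integral_cst// lte_mul_pinfty ?lee_fin ?sqr_ge0//.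
exact: lebesgue0_lty.
Qed.

Lemma norm_model_eigenfun_le1 bc L i x : `|model_eigenfun bc L i x| <= 1.
Proof. by case: bc; [exact: sin_max|exact: cos_max]. Qed.

Lemma model_eigenfun_Lfun2 bc L i :
  (model_eigenfun bc L i : measurableTypeR R -> R) \in Lfun (lebesgue0 L) 2%:E.
Proof.
apply: (@bounded_Lfun2 _ _ 1); last exact: norm_model_eigenfun_le1.
by apply: continuous_measurable_fun; exact: continuous_model_eigenfun.
Qed.

Definition model_eigenvec bc L i : L2 L :=
  Lclass (Lfun_Sub _ (model_eigenfun_Lfun2 bc L i)).

Lemma model_eigenvec_ae bc L i :
  model_eigenvec bc L i = model_eigenfun bc L i %[ae lebesgue0 L].
Proof. exact: Lclass_ae. Qed.

Lemma L2_indic_ae L (i : interval R) :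
  L2_indic L i = (\1_[set` i] : R -> R) %[ae lebesgue0 L].
Proof. exact: Lclass_ae. Qed.

Lemma continuous_Rintegral_oo (f : R -> R) x y : continuous f ->
  \int[lebesgue_measure]_(z in `]x, y[) f z = \int[lebesgue_measure]_(z in `[x, y]) f z.
Proof.
move=> cf.
have ico : (@lebesgue_measure R).-integrable `[x, y[ (EFin \o f).
  apply: integrableS (continuous_itv_integrable f x y cf) => //.
  by apply: subset_itv; rewrite bnd_simp.
rewrite -(Rintegral_itv_bndo_bndc ico) Rintegral_itv_obnd_cbnd//.
apply: integrableS ico => //; by apply: subset_itv; rewrite bnd_simp.
Qed.

Lemma L2_inner_interval L (F G : L2 L) (f g : R -> R) :
  measurable_fun setT f -> measurable_fun setT g ->
  F = f %[ae lebesgue0 L] -> G = g %[ae lebesgue0 L] ->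
  L2_inner F G = \int[lebesgue_measure]_(x in `]0, L[) (f x * g x).
Proof.
move=> mf mg Ff Gg; transitivity (\int[lebesgue0 L]_x (f x * g x)).
  exact: L2_inner_ae.
by apply: lebesgue0_Rintegral; exact: measurable_funM.
Qed.

Lemma L2_inner_continuous L (F G : L2 L) (f g : R -> R) :
  continuous f -> continuous g ->
  F = f %[ae lebesgue0 L] -> G = g %[ae lebesgue0 L] ->
  L2_inner F G = \int[lebesgue_measure]_(x in `[0, L]) (f x * g x).
Proof.
move=> cf cg Ff Gg.
have mf := continuous_measurable_fun cf; have mg := continuous_measurable_fun cg.
rewrite (L2_inner_interval _ _ _ _ _ mf mg Ff Gg).
by apply: continuous_Rintegral_oo => x; apply: cvgM; [exact: cf|exact: cg].
Qed.

Lemma L2_inner_indic_continuous L c h (G : L2 L) (g : R -> R) :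
  [set` centered_itv c h] `<=` `]0, L[ ->
  continuous g -> G = g %[ae lebesgue0 L] ->
  L2_inner (L2_indic L (centered_itv c h)) G =
  \int[lebesgue_measure]_(x in `[c - h, c + h]) g x.
Proof.
move=> hL cg Gg; have mg := continuous_measurable_fun cg.
have mi : measurable_fun setT (\1_[set` centered_itv c h] : R -> R).
  exact: measurable_indic.
rewrite (L2_inner_interval _ _ _ _ _ mi mg (L2_indic_ae _ _) Gg).
rewrite -continuous_Rintegral_oo// -[in RHS](setIidr hL) Rintegral_mkcondr.
apply: eq_Rintegral => x _; rewrite patchE indicE.
by case: ifP; rewrite ?mul1r ?mul0r.
Qed.

Lemma L2_inner_indic L c c' h :
  [set` centered_itv c h] `<=` `]0, L[ ->
  L2_inner (L2_indic L (centered_itv c h)) (L2_indic L (centered_itv c' h)) =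
  fine (lebesgue_measure ([set` centered_itv c h] `&` [set` centered_itv c' h])).
Proof.
move=> hL.
have mi b : measurable_fun setT (\1_[set` centered_itv b h] : R -> R).
  exact: measurable_indic.
rewrite (L2_inner_interval _ _ _ _ _ (mi c) (mi c') (L2_indic_ae _ _) (L2_indic_ae _ _)).
transitivity (\int[lebesgue_measure]_(x in `]0, L[)
    (\1_([set` centered_itv c h] `&` [set` centered_itv c' h]) x : R)).
  by apply: eq_Rintegral => x _; rewrite indicI.
rewrite /Rintegral integral_indic//; last exact: measurableI.
by congr (fine (_ _)); rewrite setIAC (setIidl hL).
Qed.

End L2_interval.

(** * Classification of the eigenfunctions *)

Section linear_ode.
Context {R : realType}.
Implicit Types (f g c s : R -> R) (l x y L : R).

Lemma is_derive0_cst_oo f a b : (forall x, a < x < b -> is_derive x 1 f 0) ->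
  forall x y, a < x < b -> a < y < b -> f x = f y.
Proof.
move=> df; suff H x y : a < x < b -> a < y < b -> x <= y -> f x = f y.
  by move=> x y xab yab; have [xy|/ltW xy] := leP x y; [|symmetry]; apply: H.
move=> /andP[ax xb] /andP[ay yb] xy.
have dfxy z : z \in `[x, y] -> is_derive z 1 f 0.
  rewrite in_itv/= => /andP[xz zy].
  by apply: df; rewrite (lt_le_trans ax)//= (le_lt_trans zy).
have dfo z : z \in `]x, y[ -> is_derive z 1 f 0.
  by rewrite in_itv/= => /andP[xz zy]; apply: dfxy; rewrite in_itv/= !ltW.
have cf : {within `[x, y], continuous f}.
  apply: continuous_in_subspaceT => z /[!inE] zxy.
  exact: (is_derive_continuous (dfxy _ zxy)).
have [z _] := MVT_segment xy dfo cf.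
by rewrite mul0r => /eqP; rewrite subr_eq0 => /eqP.
Qed.

(* [c] and [s] solve y'' = - l y with the initial data of cosine and sine. *)
Record fundamental_solutions l c s : Prop := FundamentalSolutions {
  fs_s : forall x, is_derive x 1 s (c x);
  fs_c : forall x, is_derive x 1 c (- l * s x);
  fs_s0 : s 0 = 0;
  fs_c0 : c 0 = 1;
  fs_wronskian : forall x, c x ^+ 2 + l * s x ^+ 2 = 1 }.

(** The matrix with rows (c, s) and (- l s, c) has determinant 1 by [fs_wronskian]. Applying its
    inverse to (f, g) produces [a] and [b], whose derivatives cancel by the equation, so both are
    constant on the open interval. *)
Lemma fundamental_solutions_span l c s f g L : fundamental_solutions l c s ->
  (forall x, 0 < x < L -> is_derive x 1 f (g x)) ->
  (forall x, 0 < x < L -> is_derive x 1 g (- l * f x)) -> 0 < L ->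
  exists A B, forall x, 0 < x < L ->
    f x = A * c x + B * s x /\ g x = - l * A * s x + B * c x.
Proof.
move=> [ds dc _ _ w1] df dg L0.
pose a x := f x * c x - g x * s x; pose b x := l * (f x * s x) + g x * c x.
have x0 : 0 < L / 2 < L by rewrite divr_gt0//= ltr_pdivrMr// ltr_pMr// ltr1n.
have da x : 0 < x < L -> is_derive x 1 a 0.
  move=> xL; apply: (is_derive_eq (is_deriveB (is_deriveM (df x xL) (dc x))
                                               (is_deriveM (dg x xL) (ds x)))).
  by rewrite /GRing.scale/=; ring.
have db x : 0 < x < L -> is_derive x 1 b 0.
  move=> xL; apply: (is_derive_eq (is_deriveD (is_deriveZ l (is_deriveM (df x xL) (ds x)))
                                               (is_deriveM (dg x xL) (dc x)))).
  by rewrite /GRing.scale/=; ring.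
(* Nothing is known of [f] at the endpoints, so the constants are read off at an interior point. *)
exists (a (L / 2)), (b (L / 2)) => x xL.
rewrite (is_derive0_cst_oo _ _ _ da _ _ x0 xL) (is_derive0_cst_oo _ _ _ db _ _ x0 xL).
split; rewrite /a /b.
  by rewrite -[LHS]mulr1 -(w1 x); ring.
by rewrite -[LHS]mulr1 -(w1 x); ring.
Qed.

Lemma is_derive_expR_mull (w x : R) :
  is_derive x 1 (fun y => expR (w * y)) (w * expR (w * x)).
Proof.
rewrite mulrC.
exact: (is_derive1_comp (is_derive_expR (w * x)) (is_derive_mull w x)).
Qed.

(** The pair is cosh (w x), sinh (w x) / w for l < 0, cos (w x), sin (w x) / w for l > 0, and 1, x
    for l = 0. Either boundary condition will lead to [l * s L = 0]: this is impossible for l < 0,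
    where [s L > 0], and quantizes w otherwise. Writing [w * s x = sin (w * x)] without division
    also covers w = 0. *)
Lemma fundamental_solutions_exist l L : 0 < L -> exists c s,
  [/\ fundamental_solutions l c s, l = 0 -> s L != 0 &
      l * s L = 0 -> exists k : nat, let w := k%:R * (pi / L) in
        l = w ^+ 2 /\ (forall x, c x = cos (w * x) /\ w * s x = sin (w * x))].
Proof.
move=> L0; have [l0|l0|->] := ltgtP l 0.
- pose w := Num.sqrt (- l).
  have w0 : 0 < w by rewrite sqrtr_gt0 oppr_gt0.
  have wN0 := lt0r_neq0 w0.
  have w2 : l = - w ^+ 2 by rewrite sqr_sqrtr ?opprK// oppr_ge0 ltW.
  exists (fun x => 2^-1 * expR (w * x) + 2^-1 * expR (- w * x)).
  exists (fun x => (2 * w)^-1 * expR (w * x) - (2 * w)^-1 * expR (- w * x)).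
  have sL : 0 < (2 * w)^-1 * expR (w * L) - (2 * w)^-1 * expR (- w * L).
    rewrite -mulrBr mulr_gt0 ?invr_gt0 ?mulr_gt0// subr_gt0 ltr_expR mulNr.
    by rewrite gtrN ?mulr_gt0.
  split; first split.
  + move=> x; apply: (is_derive_eq
      (is_deriveB (is_deriveZ (2 * w)^-1 (is_derive_expR_mull w x))
                  (is_deriveZ (2 * w)^-1 (is_derive_expR_mull (- w) x)))).
    by rewrite /GRing.scale/=; field.
  + move=> x; apply: (is_derive_eq
      (is_deriveD (is_deriveZ 2^-1 (is_derive_expR_mull w x))
                  (is_deriveZ 2^-1 (is_derive_expR_mull (- w) x)))).
    by rewrite /GRing.scale/= w2; field.
  + by rewrite !mulr0 subrr.
  + by rewrite !mulr0 expR0; field.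
  + move=> x; have e1 : expR (w * x) * expR (- w * x) = 1.
      by rewrite -expRD mulNr subrr expR0.
    by rewrite -[RHS]e1 w2; field.
  + by move=> l00; rewrite l00 ltxx in l0.
  + by move=> /eqP; rewrite mulf_eq0 (lt_eqF l0) (gt_eqF sL).
- pose w := Num.sqrt l.
  have w0 : 0 < w by rewrite sqrtr_gt0.
  have wN0 := lt0r_neq0 w0.
  have w2 : l = w ^+ 2 by rewrite sqr_sqrtr// ltW.
  exists (fun x => cos (w * x)), (fun x => w^-1 * sin (w * x)).
  split; first split.
  + move=> x; have := is_deriveZ w^-1 (is_derive_sin_mull w x).
    by rewrite /GRing.scale/= mulKf.
  + move=> x; apply: (is_derive_eq (is_derive_cos_mull w x)).
    by rewrite w2; field.
  + by rewrite mulr0 sin0 mulr0.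
  + by rewrite mulr0 cos0.
  + by move=> x; rewrite -(cos2Dsin2 (w * x)) w2; field.
  + by move=> l00; rewrite l00 ltxx in l0.
  + move=> /eqP; rewrite !mulf_eq0 invr_eq0 (gt_eqF l0) (gt_eqF w0)/= => /eqP sL.
    have [|k wL] := sin_eq0_natpi (w * L) _ sL; first by rewrite mulr_ge0 ?ltW.
    exists k; have wE : k%:R * (pi / L) = w.
      by rewrite mulrA -wL mulfK// gt_eqF.
    by rewrite /= wE; split=> // x; rewrite mulVKf.
- exists (fun=> 1), id; split; first split => //.
  + by move=> x; exact: is_derive_id.
  + by move=> x; rewrite oppr0 mul0r; exact: is_derive_cst.
  + by move=> x; rewrite mul0r addr0 expr1n.
  + by move=> _; rewrite gt_eqF.
  + move=> _; exists 0%N => /=; rewrite mul0r expr0n; split=> // x.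
    by rewrite !mul0r cos0 sin0.
Qed.

End linear_ode.

(** * From weak eigenfunctions to sines and cosines *)

Section eigenfunction_classification.
Context {R : realType}.
Implicit Types (bc : boundary_condition) (L l x y : R) (i k : nat).

(** The values of [f] at 0 and L are unconstrained, so its one-sided limits are transferred to the
    continuous function [h]. *)
Lemma one_sided_limits_eq (f h : R -> R) L : 0 < L -> continuous h ->
  (forall x, 0 < x < L -> f x = h x) ->
  f x @[x --> 0^'+] --> 0 -> f x @[x --> L^'-] --> 0 -> h 0 = 0 /\ h L = 0.
Proof.
move=> L0 ch fh f0 fL; split.
- have h0 : h x @[x --> 0^'+] --> h 0 by exact: cvg_at_right_filter (ch 0).
  apply: (@cvg_unique _ _ (h x @[x --> 0^'+])) => //.
  apply: cvg_trans f0; apply: near_eq_cvg; near=> x; apply: fh.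
  by apply/andP; split; near: x; [exact: nbhs_right_gt|exact: nbhs_right_lt].
- have hL : h x @[x --> L^'-] --> h L by exact: cvg_at_left_filter (ch L).
  apply: (@cvg_unique _ _ (h x @[x --> L^'-])) => //.
  apply: cvg_trans fL; apply: near_eq_cvg; near=> x; apply: fh.
  by apply/andP; split; near: x; [exact: nbhs_left_gt|exact: nbhs_left_lt].
Unshelve. all: by end_near. Qed.

Lemma Lspace_eq0 L (F : L2 L) (f : R -> R) :
  F = f %[ae lebesgue0 L] -> (forall x, 0 < x < L -> f x = 0) -> F = 0.
Proof.
move=> Ff f0; apply: LspaceP.
have f00 : f = (fun=> 0) %[ae lebesgue0 L] by exact: lebesgue0_ae_eq.
exact: (ae_eq_trans Ff (ae_eq_trans f00 (ae_eq_sym (Lclass_ae 0)))).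
Qed.

(** Regularity bootstrap: [f] is differentiable, hence continuous, so the integral expressing the
    increments of its derivative has a continuous integrand and can itself be differentiated. *)
Lemma eigenfunction_strong L bc l (F : L2 L) : eigenfunction bc l F ->
  exists f : R -> R, [/\ F = f %[ae lebesgue0 L],
    forall x, 0 < x < L -> is_derive x 1 f ((derive1 f) x),
    forall x, 0 < x < L -> is_derive x 1 (derive1 f) (- l * f x) &
    satisfies_bc bc L f].
Proof.
move=> [_ [f [Ff df intf bcf]]]; exists f; split=> // x xL.
  by apply: DeriveDef; [exact: df|rewrite derive1E].
have cf z : 0 < z < L -> {for z, continuous f}.
  by move=> zL; exact/differentiable_continuous/derivable1_diffP/df.
have /andP[x0 xL'] := xL.
(* Continuity of [f] holds only inside (0, L), so the fundamental theorem is applied on a compact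
   window [a, b] around [x]. *)
pose a := x / 2; pose b := (x + L) / 2.
have a0 : 0 < a by rewrite divr_gt0.
have ax : a < x by rewrite ltr_pdivrMr// ltr_pMr// ltr1n.
have xb : x < b by rewrite ltr_pdivlMr// mulr2n mulrDr mulr1 ltrD2l.
have bL : b < L by rewrite ltr_pdivrMr// mulr2n mulrDr mulr1 ltrD2r.
have cg z : 0 < z < L -> {for z, continuous (fun z => l * f z)}.
  by move=> zL; apply: cvgM; [exact: cvg_cst|exact: cf].
have cgw y : y < L -> {within `[a, y], continuous (fun z => l * f z)}.
  move=> yL; apply: continuous_in_subspaceT => z /[!inE]/=; rewrite in_itv/= => /andP[az zy].
  by apply: cg; rewrite (lt_le_trans a0 az) (le_lt_trans zy).
have lFf : (l *: F : L2 L) = (fun z => l * f z) %[ae lebesgue0 L].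
  move: (Lspace_scaleE l F) Ff.
  by apply: filterS2 => z /(_ I) + /(_ I) + _ => -> ->.
have mlF : measurable_fun setT ((l *: F : L2 L) : R -> R).
  exact (@measurable_Lspace _ _ _ (lebesgue0 L) (l *: F)).
pose P y := \int[lebesgue_measure]_(z in `[a, y]) (l * f z).
have f'E y : a < y < L -> (derive1 f) y = (derive1 f) a - P y.
  move=> /andP[ay yL].
  rewrite /P -(lebesgue0_Rintegral_ae_itv _ _ _ _ _ a0 yL mlF (cgw y yL) lFf).
  by rewrite -intf ?subKr// ltW.
have [|dP P'E] := @continuous_FTC1_closed R (fun z => l * f z) a x b xb _ ax (cg x xL).
  by apply: continuous_compact_integrable; [exact: segment_compact|exact: cgw].
have dPx : is_derive x 1 P (l * f x).
  by apply: DeriveDef; [exact: dP|rewrite -derive1E].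
apply: (@near_eq_is_derive _ _ _ (cst ((derive1 f) a) - P)).
  near=> y; apply/esym/f'E/andP; split; near: y.
    exact: lt_nbhsr.
  exact: lt_nbhsl.
by apply: (is_derive_eq (is_deriveB (is_derive_cst _ _ _) dPx)); rewrite sub0r mulNr.
Unshelve. all: by end_near. Qed.

(** The condition at 0 removes one of the two constants, the condition at L then gives
    [l * s L = 0], and F being nonzero excludes the vanishing of both constants. *)
Lemma eigenfunction_model L bc l (F : L2 L) : 0 < L -> eigenfunction bc l F ->
  exists i a, l = frequency bc L i ^+ 2 /\ F = a *: model_eigenvec bc L i.
Proof.
move=> L0 eF; have [f [Ff df ddf bcf]] := eigenfunction_strong _ _ _ _ eF.
have [c [s [fs sL0 lsL]]] := fundamental_solutions_exist l L L0.
have [A [B fE]] := fundamental_solutions_span _ _ _ _ _ _ fs df ddf L0.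
have [ds dc s0 c0 _] := fs.
have F0 (h : R -> R) : (forall x, 0 < x < L -> f x = h x) -> ~ (forall x, h x = 0).
  move=> fh h0; case: eF => /eqP + _; apply; apply: (Lspace_eq0 _ _ _ Ff) => x xL.
  by rewrite fh.
have cont p q : continuous (fun x => p * c x + q * s x).
  move=> x; apply: cvgD; (apply: cvgM; first exact: cvg_cst).
    exact: is_derive_continuous (dc x).
  exact: is_derive_continuous (ds x).
have to_model i a : (forall x, 0 < x < L -> f x = a * model_eigenfun bc L i x) ->
    F = a *: model_eigenvec bc L i.
  move=> fa; apply: LspaceP; apply: ae_eq_trans Ff _.
  apply: ae_eq_trans (lebesgue0_ae_eq _ _ _ fa) _; apply: ae_eq_sym.
  move: (Lspace_scaleE a (model_eigenvec bc L i)) (model_eigenvec_ae bc L i).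
  by apply: filterS2 => z /(_ I) + /(_ I) + _ => -> ->.
case: bc bcf eF to_model => -[lim0 limL] eF to_model.
- have [] := one_sided_limits_eq f _ L L0 (cont A B) (fun x xL => (fE x xL).1) lim0 limL.
  rewrite c0 s0 mulr1 mulr0 addr0 => A0; rewrite A0 mul0r add0r => /eqP.
  rewrite mulf_eq0 => /orP[/eqP B0|/eqP sL].
    by exfalso; apply: (F0 _ (fun x xL => (fE x xL).1)) => x; rewrite A0 B0 !mul0r addr0.
  (* Wave number 0 would give l = 0, where [s L] is nonzero; hence the shift to [i.+1]. As s x = sin
     (w x) / w, the amplitude becomes B / w. *)
  have [|[|i] [lE csE]] := lsL; first by rewrite sL mulr0.
    by have := sL0; rewrite lE mul0r expr0n sL eqxx => /(_ erefl).
  exists i, (B / frequency Dirichlet L i); split=> //; apply: to_model => x xL.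
  have w0 : frequency Dirichlet L i != 0.
    by rewrite !mulf_neq0 ?invr_eq0 ?gt_eqF ?pi_gt0.
  have [_ sE] := csE x.
  rewrite (fE x xL).1 A0 mul0r add0r /model_eigenfun/= /frequency/= -sE.
  by rewrite mulrA divfK.
- have [] := one_sided_limits_eq (derive1 f) (fun x => B * c x + (- l * A) * s x) L L0 (cont _ _)
     (fun x xL => etrans (fE x xL).2 (addrC _ _)) lim0 limL.
  rewrite c0 s0 mulr1 mulr0 addr0 => B0; rewrite B0 mul0r add0r => /eqP.
  (* Keeping [l * s L] as one factor treats the constant mode l = 0 together with the other
     eigenvalues. *)
  rewrite mulNr mulNr oppr_eq0 mulrAC mulf_eq0 => /orP[/eqP lsL0|/eqP A0]; last first.
    by exfalso; apply: (F0 _ (fun x xL => (fE x xL).1)) => x; rewrite A0 B0 !mul0r addr0.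
  have [i [lE csE]] := lsL lsL0.
  exists i, A; split=> //; apply: to_model => x xL.
  by rewrite (fE x xL).1 B0 mul0r addr0 (csE x).1.
Qed.

Definition model_eigenfun_derivative bc L i x : R :=
  let w := frequency bc L i in
  if bc is Dirichlet then w * cos (w * x) else - (w * sin (w * x)).

Lemma is_derive_model_eigenfun bc L i x :
  is_derive x 1 (model_eigenfun bc L i) (model_eigenfun_derivative bc L i x).
Proof. by case: bc; [exact: is_derive_sin_mull|exact: is_derive_cos_mull]. Qed.

Lemma is_derive_model_eigenfun_derivative bc L i x :
  is_derive x 1 (model_eigenfun_derivative bc L i)
    (- frequency bc L i ^+ 2 * model_eigenfun bc L i x).
Proof.
case: bc => /=.
- apply: (is_derive_eq (is_deriveZ _ (is_derive_cos_mull _ x))).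
  by rewrite /GRing.scale/= /model_eigenfun/=; ring.
- apply: (is_derive_eq (is_deriveN (is_deriveZ _ (is_derive_sin_mull _ x)))).
  by rewrite /GRing.scale/= /model_eigenfun/=; ring.
Qed.

Lemma derive1_model_eigenfun bc L i :
  derive1 (model_eigenfun bc L i) = model_eigenfun_derivative bc L i.
Proof.
by apply/funext => x; rewrite derive1E; have [_] := is_derive_model_eigenfun bc L i x.
Qed.

Lemma L2_inner_model_eigenvec bc L i k :
  L2_inner (model_eigenvec bc L i) (model_eigenvec bc L k) =
  \int[lebesgue_measure]_(x in `[0, L])
     (model_eigenfun bc L i x * model_eigenfun bc L k x).
Proof.
apply: L2_inner_continuous; do ?exact: continuous_model_eigenfun.
  exact: model_eigenvec_ae.
exact: model_eigenvec_ae.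
Qed.

Lemma model_eigenvec_norm bc L i : 0 < L ->
  L / 2 <= L2_inner (model_eigenvec bc L i) (model_eigenvec bc L i) <= L.
Proof. by move=> L0; rewrite L2_inner_model_eigenvec integral_model_eigenfun_norm. Qed.

Lemma model_eigenvec_neq0 bc L i : 0 < L -> model_eigenvec bc L i != 0.
Proof.
move=> L0; apply/eqP => e0; have /andP[+ _] := model_eigenvec_norm bc L i L0.
rewrite leNgt => /negP; apply; rewrite e0.
have := L2_inner_linear (0 : L2 L) 1 0 0.
rewrite scale1r add0r mul1r => /eqP; rewrite -subr_eq0 opprD addrA subrr sub0r oppr_eq0.
by move=> /eqP->; rewrite divr_gt0.
Qed.

(** This converse of [eigenfunction_model], combined with the completeness clause of
    [eigenfunction_sequence], shows that [lam] skips no model eigenvalue. *)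
Lemma eigenfunction_model_eigenvec bc L i : 0 < L ->
  eigenfunction bc (frequency bc L i ^+ 2) (model_eigenvec bc L i).
Proof.
move=> L0; split; first exact: model_eigenvec_neq0.
set w := frequency bc L i.
have cd : continuous (model_eigenfun_derivative bc L i).
  by move=> x; exact: is_derive_continuous (is_derive_model_eigenfun_derivative bc L i x).
exists (model_eigenfun bc L i); rewrite derive1_model_eigenfun; split.
- exact: model_eigenvec_ae.
- by move=> x _; have [] := is_derive_model_eigenfun bc L i x.
- move=> x y x0 xy yL.
  have cg : continuous (fun z => w ^+ 2 * model_eigenfun bc L i z).
    by move=> z; apply: cvgM; [exact: cvg_cst|exact: continuous_model_eigenfun].
  have wE : (w ^+ 2 *: model_eigenvec bc L i : L2 L) =
      (fun z => w ^+ 2 * model_eigenfun bc L i z) %[ae lebesgue0 L].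
    move: (Lspace_scaleE (w ^+ 2) (model_eigenvec bc L i)) (model_eigenvec_ae bc L i).
    by apply: filterS2 => z /(_ I) + /(_ I) + _ => -> ->.
  have mwE : measurable_fun setT ((w ^+ 2 *: model_eigenvec bc L i : L2 L) : R -> R).
    exact (@measurable_Lspace _ _ _ (lebesgue0 L) (w ^+ 2 *: model_eigenvec bc L i)).
  rewrite (lebesgue0_Rintegral_ae_itv _ _ _ _ _ x0 yL mwE (continuous_subspaceT cg) wE).
  move: xy; rewrite le_eqVlt => /predU1P[->|xy].
    by rewrite subrr set_itv1 Rintegral_set1.
  have dF (z : R) : is_derive z 1 (- model_eigenfun_derivative bc L i)
      (w ^+ 2 * model_eigenfun bc L i z).
    apply: (is_derive_eq (is_deriveN (is_derive_model_eigenfun_derivative bc L i z))).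
    by rewrite mulNr opprK.
  by rewrite (Rintegral_FTC2 _ _ _ _ xy cg dF) !fctE opprK addrC.
- have lims (g : R -> R) : continuous g -> g 0 = 0 -> g L = 0 ->
      g x @[x --> 0^'+] --> 0 /\ g x @[x --> L^'-] --> 0.
    move=> cg g0 gL; split.
      by rewrite -[X in _ --> X]g0; exact: cvg_at_right_filter (cg 0).
    by rewrite -[X in _ --> X]gL; exact: cvg_at_left_filter (cg L).
  have wL : w * L = (wave_number bc i)%:R * pi.
    by rewrite /w /frequency -mulrA divfK// gt_eqF.
  have swL : sin (w * L) = 0 by rewrite wL sin_mulr_natpi.
  rewrite /satisfies_bc derive1_model_eigenfun; rewrite /w in swL.
  case: bc cd w wL swL => cd w wL swL; apply: lims => //.
  + exact: continuous_model_eigenfun.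
  + by rewrite /model_eigenfun/= mulr0 sin0.
  + by rewrite /model_eigenfun_derivative mulr0 sin0 mulr0 oppr0.
  + by rewrite /model_eigenfun_derivative swL mulr0 oppr0.
Qed.

(** Writing a i = b (n i), the index map n is strictly increasing, so i <= n i and b i <= b (n i) =
    a i. Exchanging the sequences gives equality. *)
Lemma strictly_increasing_enum_unique (u v : nat -> R) :
  (forall i j, (i < j)%N -> u i < u j) -> (forall i j, (i < j)%N -> v i < v j) ->
  (forall i, exists n, u i = v n) -> (forall n, exists i, v n = u i) -> u =1 v.
Proof.
suff H (a b : nat -> R) : (forall i j, (i < j)%N -> a i < a j) ->
    (forall i j, (i < j)%N -> b i < b j) ->
    (forall i, exists n, a i = b n) -> forall i, b i <= a i.
  move=> hu hv uv vu i; apply/eqP; rewrite eq_le (H v u)//; exact: (H u v).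
move=> ha hb ab i; have [n] := choice ab => an.
have n_mono j k : (j < k)%N -> (n j < n k)%N.
  move=> jk; rewrite ltnNge; apply/negP => nkj.
  have : a k <= a j.
    rewrite !an; move: nkj; rewrite leq_eqVlt => /predU1P[->//|/hb/ltW//].
  by rewrite leNgt ha.
have leb j k : (j <= k)%N -> b j <= b k.
  by rewrite leq_eqVlt => /predU1P[->//|/hb/ltW].
rewrite an; apply: leb; elim: i => // i IH.
by rewrite (leq_ltn_trans IH)// n_mono.
Qed.

Lemma frequency_sqr_lt bc L i j : 0 < L -> (i < j)%N ->
  frequency bc L i ^+ 2 < frequency bc L j ^+ 2.
Proof.
move=> L0 ij; rewrite ltrXn2r ?nnegrE ?frequency_ge0//.
by rewrite ltr_pM2r ?divr_gt0 ?pi_gt0// ltr_nat wave_number_lt.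
Qed.

(** [phi i] is a multiple of some model eigenvector; once the two enumerations of eigenvalues agree,
    its eigenvalue forces the index to be [i]. *)
Lemma eigenfunction_sequence_model bc L (lam : nat -> R) (phi : nat -> L2 L) :
  0 < L -> eigenfunction_sequence bc lam phi ->
  exists a : nat -> R, forall i, a i != 0 /\ phi i = a i *: model_eigenvec bc L i.
Proof.
move=> L0 [ephi lam_lt lam_all].
have model_ex i := eigenfunction_model L bc _ _ L0 (ephi i).
have lamE : lam =1 (fun i => frequency bc L i ^+ 2).
  apply: strictly_increasing_enum_unique => //.
  - by move=> i j; exact: frequency_sqr_lt.
  - by move=> i; have [n [a [? _]]] := model_ex i; exists n.
  - by move=> n; exact: lam_all (eigenfunction_model_eigenvec bc L n L0).
suff aP i : exists a, a != 0 /\ phi i = a *: model_eigenvec bc L i.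
  by have [a aE] := choice aP; exists a.
have [n [a [lin phin]]] := model_ex i.
have ni : n = i.
  move: lin; rewrite lamE => fE.
  by have [/(frequency_sqr_lt bc L _ _ L0)|/(frequency_sqr_lt bc L _ _ L0)|//] :=
    ltngtP n i; rewrite fE ltxx.
exists a; split; last by rewrite phin ni.
have [phi0 _] := ephi i; apply: contra phi0 => /eqP a0.
by rewrite phin a0 scale0r.
Qed.

End eigenfunction_classification.

(** * Uniform bound *)

Section actuators.
Context {R : realType}.
Implicit Types (r L x h : R) (M : nat).

Lemma centered_itvP c h x : [set` centered_itv c h] x <-> c - h < x < c + h.
Proof. by rewrite /centered_itv /= in_itv. Qed.

(** The half-width is r times half a cell, L / (2 M), so r < 1 keeps each interval strictly inside
    its own cell; disjointness rests on the same fact. *)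
Lemma midpoint_itv_sub r L M (j : 'I_M) : 0 < r < 1 -> 0 < L ->
  0 < midpoint L M j - r * L / (2 * M%:R) /\
  midpoint L M j + r * L / (2 * M%:R) < L.
Proof.
move=> /andP[r0 r1] L0.
have M0 : 0 < 2 * M%:R :> R by rewrite mulr_gt0// ltr0n (leq_ltn_trans _ (ltn_ord j)).
have jM : j%:R + 1 <= M%:R :> R by rewrite natr1 ler_nat.
have j0 : 0 <= j%:R :> R by [].
rewrite /midpoint -mulrBl -mulrDl -mulrBl -mulrDl; split.
  by rewrite divr_gt0// mulr_gt0//; lra.
rewrite ltr_pdivrMr// mulrC ltr_pM2l//; lra.
Qed.

Lemma midpoint_itv_subset r L M (j : 'I_M) : 0 < r < 1 -> 0 < L ->
  [set` centered_itv (midpoint L M j) (r * L / (2 * M%:R))] `<=` `]0, L[.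
Proof.
move=> r01 L0 x /centered_itvP/andP[xl xr] /=.
have [cl cr] := midpoint_itv_sub r L M j r01 L0.
by rewrite in_itv/= (lt_trans cl xl) (lt_trans xr cr).
Qed.

Lemma midpoint_itv_disjoint r L M (j k : 'I_M) : 0 < r < 1 -> 0 < L -> j != k ->
  [set` centered_itv (midpoint L M j) (r * L / (2 * M%:R))] `&`
  [set` centered_itv (midpoint L M k) (r * L / (2 * M%:R))] = set0.
Proof.
move=> r01 L0; wlog jk : j k / (j < k)%N => [H jk|_].
  have [/H->//|kj|/val_inj kj] := ltngtP j k; last by rewrite kj eqxx in jk.
  by rewrite setIC H// eq_sym.
rewrite -subset0 => x [/centered_itvP/andP[_ xj] /centered_itvP/andP[kx _]].
have := lt_trans kx xj; have /andP[_ r1] := r01.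
have M0 : 0 < 2 * M%:R :> R by rewrite mulr_gt0// ltr0n (leq_ltn_trans _ (ltn_ord j)).
have jkR : j%:R + 1 <= k%:R :> R by rewrite natr1 ler_nat.
rewrite /midpoint -mulrBl -mulrDl -mulrBl -mulrDl ltr_pM2r ?invr_gt0//.
by rewrite ltr_pM2r// ltNge => /negP; apply; lra.
Qed.

Lemma lin_span_scale (V : lmodType R) n (v w : 'I_n -> V) (a : 'I_n -> R) :
  (forall i, a i != 0) -> (forall i, v i = a i *: w i) -> lin_span v = lin_span w.
Proof.
move=> a0 vw; apply/seteqP; split=> [_ [b _ <-]|_ [b _ <-]].
  exists (fun i => b i * a i) => //.
  by apply: eq_bigr => i _; rewrite vw scalerA.
exists (fun i => b i / a i) => //.
by apply: eq_bigr => i _; rewrite vw scalerA divfK.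
Qed.

End actuators.

(** * The abstract bound applied to indicators and model eigenvectors *)

Section uniform_bound.
Context {R : realType}.
Variables (r L : R) (bc : boundary_condition) (M : nat).
Hypotheses (r01 : 0 < r < 1) (L0 : 0 < L) (M0 : (0 < M)%N).

Let h := r * L / (2 * M%:R).
Let psi (i : 'I_M) := model_eigenvec bc L i.
Let u (j : 'I_M) := L2_indic L (centered_itv (midpoint L M j) h).
Let m i := L2_inner (psi i) (psi i).
Let s (i : 'I_M) := averaging_factor (frequency bc L i) h.
Let S := \matrix_(i < M, j < M) model_eigenfun bc L i (midpoint L M j).
Let n i := \sum_j S i j * S i j.

Let MR0 : 0 < M%:R :> R. Proof. by rewrite ltr0n. Qed.

Let r0 : 0 < r. Proof. by case/andP: r01. Qed.

Let h0 : 0 < h. Proof. by rewrite divr_gt0 ?mulr_gt0. Qed.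

Let cosr0 : 0 < cos (pi * r / 2).
Proof.
apply: cos_gt0_pihalf; have /andP[_ r1] := r01; have := pi_gt0 R => pi0.
have pr0 : 0 < pi * r / 2 by rewrite divr_gt0 ?mulr_gt0.
rewrite (lt_trans _ pr0) ?oppr_lt0 ?divr_gt0//=.
by rewrite ltr_pM2r ?invr_gt0// gtr_pMr.
Qed.

Let psi_orth i k : L2_inner (psi i) (psi k) = m i *+ (i == k).
Proof.
case: eqVneq => [->//|ik]; rewrite mulr0n L2_inner_model_eigenvec.
exact: integral_model_eigenfun_orth.
Qed.

(** Here [h] is a half-width, so the constant of the abstract bound is [2 * h]. *)
Let u_orth j k : L2_inner (u j) (u k) = (2 * h) *+ (j == k).
Proof.
rewrite L2_inner_indic; last exact: midpoint_itv_subset.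
case: eqVneq => [->|jk]; last by rewrite midpoint_itv_disjoint// measure0.
have hh : midpoint L M k - h < midpoint L M k + h by rewrite ltrD2l gtrN.
by rewrite setIid lebesgue_measure_itv/= lte_fin hh -EFinB/= mulr1n; ring.
Qed.

Let u_psi j i : L2_inner (u j) (psi i) = s i * S i j.
Proof.
rewrite (L2_inner_indic_continuous _ _ _ _ (model_eigenfun bc L i)).
- by rewrite mxE; exact: integral_trig_centered.
- exact: midpoint_itv_subset.
- exact: continuous_model_eigenfun.
- exact: model_eigenvec_ae.
Qed.

Let S_orth i k : \sum_j S i j * S k j = n i *+ (i == k).
Proof.
case: eqVneq => [->//|ik]; rewrite mulr0n.
under eq_bigr do rewrite !mxE.
by rewrite model_eigenfun_grid_orth// gt_eqF.
Qed.

Let m_bounds i : L / 2 <= m i <= L. Proof. exact: model_eigenvec_norm. Qed.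

Let m_gt0 i : 0 < m i.
Proof. by have /andP[+ _] := m_bounds i; apply: lt_le_trans; rewrite divr_gt0. Qed.

Let n_ge i : M%:R / 2 <= n i.
Proof.
rewrite /n; under eq_bigr do rewrite !mxE.
by rewrite model_eigenfun_grid_norm// gt_eqF.
Qed.

Let n_gt0 i : 0 < n i.
Proof. by apply: lt_le_trans (n_ge i); rewrite divr_gt0. Qed.

(** All wave numbers are at most M, so w_i h <= M (pi / L) r L / (2 M) = pi r / 2, with equality at
    the highest Dirichlet mode. *)
Let s_ge i : 2 * h * cos (pi * r / 2) <= s i.
Proof.
apply: averaging_factor_ge => //; first exact: frequency_ge0.
have pi0 := pi_gt0 R; apply/andP; split; last first.
  by rewrite ler_pM2r ?invr_gt0// ler_piMr ?ltW//; case/andP: r01.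
have -> : pi * r / 2 = M%:R * (pi / L) * h.
  by rewrite /h; field; rewrite !gt_eqF.
rewrite ler_pM2r// ler_pM2r ?divr_gt0// ler_nat.
by case: bc => /=; rewrite // ltnW.
Qed.

Let s_gt0 i : 0 < s i.
Proof. by apply: lt_le_trans (s_ge i); rewrite mulr_gt0// mulr_gt0. Qed.

(* The ratio of [2 h m_i <= r L^2 / M] to [s_i^2 n_i >= (2 h cos (pi r / 2))^2 M / 2],
   where [m_i] and [n_i] are the squared norms of the eigenfunctions and of the rows of [S]. *)
Definition projection_bound (q : R) : R := 2 / (q * cos (pi * q / 2) ^+ 2).

Lemma projection_bound_ge1 : 1 <= projection_bound r.
Proof.
have /andP[_ r1] := r01.
rewrite /projection_bound ler_pdivlMr ?mulr_gt0 ?exprn_gt0// mul1r.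
have c1 : cos (pi * r / 2) ^+ 2 <= 1 by rewrite expr_le1 ?cos_le1// ltW.
apply: (@le_trans _ _ 1); last by rewrite ler1n.
by apply: mulr_ile1 => //; rewrite ?exprn_ge0// ltW.
Qed.

Let bound_terms i : (2 * h) * m i <= projection_bound r * (s i ^+ 2 * n i).
Proof.
set C := projection_bound r; set c := cos (pi * r / 2).
have C0 : 0 < C := lt_le_trans ltr01 projection_bound_ge1.
apply: (@le_trans _ _ (2 * h * L)).
  have /andP[_ mL] := m_bounds i.
  by apply: ler_wpM2l => //; rewrite ltW// mulr_gt0.
apply: (@le_trans _ _ (C * ((2 * h * c) ^+ 2 * (M%:R / 2)))).
  (* This comparison is an equality because 2 h M = r L, and it is what fixes the value of
     [projection_bound]. *)
  rewrite le_eqVlt; apply/orP; left; apply/eqP.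
  by rewrite /C /projection_bound -/c /h; field; rewrite !gt_eqF.
rewrite ler_pM2l//; apply: ler_pM => //; first exact: sqr_ge0.
- have hc0 : 0 < 2 * h * c by rewrite mulr_gt0// mulr_gt0.
  by rewrite lerXn2r ?nnegrE ?(ltW hc0) ?(ltW (s_gt0 i)).
Qed.

Let E := lin_span psi.
Let U := lin_span u.

Lemma direct_sum_indic_model : direct_sum U (L2_orth E).
Proof.
exact: (direct_sum_biorthogonal _ _ _ (@L2_inner_linear _ _ _ (lebesgue0 L))
  (@L2_innerC _ _ _ (lebesgue0 L)) _ _ _ _ _ _ u_psi S_orth n_gt0 s_gt0).
Qed.

Lemma opnorm_oblique_proj_le :
  (L2_opnorm (oblique_proj U (L2_orth E)) <= (projection_bound r)%:E)%E.
Proof.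
have C1 := projection_bound_ge1; have C0 := le_trans ler01 C1.
apply: ge_ereal_sup => _ [F /= + <-]; rewrite !L2_normE !lee_fin => F1.
have FF1 : L2_inner F F <= 1.
  by rewrite -(sqr_sqrtr (L2_inner_ge0 F)) expr_le1// sqrtr_ge0.
have := oblique_proj_le _ _ _ (@L2_inner_linear _ _ _ (lebesgue0 L))
  (@L2_innerC _ _ _ (lebesgue0 L)) (@L2_inner_ge0 _ _ _ (lebesgue0 L))
  _ _ _ _ _ _ _ _ psi_orth u_orth u_psi S_orth m_gt0 n_gt0 s_gt0 _ F C0 bound_terms.
(* [PF] bounds the squared norm by C times that of F; since C >= 1, this is at most C^2, which gives
   C for the norm itself. *)
move=> PF; rewrite -(ger0_norm C0) -sqrtr_sqr ler_wsqrtr//.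
apply: (le_trans PF); rewrite expr2 ler_wpM2l//.
exact: le_trans FF1 C1.
Qed.

End uniform_bound.

Theorem mainTheorem1 (R : realType) (r L : R) (bc : boundary_condition)
    (lam : nat -> R) (phi : nat -> L2 L) :
  0 < r < 1 -> 0 < L -> eigenfunction_sequence bc lam phi ->
  let omega (M : nat) (c : R) := centered_itv c (r * L / (2 * M%:R)) in
  let E (M : nat) : set (L2 L) := lin_span (fun i : 'I_M => phi i) in
  exists c : forall M : nat, 'I_M -> R,
    let U (M : nat) : set (L2 L) :=
      lin_span (fun j : 'I_M => L2_indic L (omega M (c M j))) in
    (forall M : nat, (1 <= M)%N ->
      [/\ forall j : 'I_M, 0 < c M j < L,
          forall j : 'I_M, [set` omega M (c M j)] `<=` `]0, L[,
          trivIset [set: 'I_M] (fun j => [set` omega M (c M j)])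
        & direct_sum (U M) (L2_orth (E M))]) /\
    exists C_P : R, 1 <= C_P /\
      forall M : nat, (1 <= M)%N ->
        (L2_opnorm (oblique_proj (U M) (L2_orth (E M))) <= C_P%:E)%E.
Proof.
move=> r01 L0 ephi omega E.
have [a aP] := eigenfunction_sequence_model bc L lam phi L0 ephi.
have EE M : E M = lin_span (fun i : 'I_M => model_eigenvec bc L i).
  by apply: (@lin_span_scale _ _ _ _ _ (fun i : 'I_M => a i)) => i; have [] := aP i.
exists (fun M j => midpoint L M j) => U; split; last first.
  exists (projection_bound r); split; first exact: projection_bound_ge1.
  by move=> M M1; rewrite EE; exact: opnorm_oblique_proj_le.
move=> M M1; split.
- move=> j; have [cl cr] := midpoint_itv_sub r L M j r01 L0.
  have h0 : 0 < r * L / (2 * M%:R).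
    by case/andP: r01 => r0 _; rewrite divr_gt0 ?mulr_gt0 ?ltr0n.
  by move: cl cr; set h := _ / (2 * M%:R) in h0 *; move=> cl cr; apply/andP; split; lra.
- by move=> j; exact: midpoint_itv_subset.
- by apply/trivIsetP => j k _ _ jk; exact: midpoint_itv_disjoint.
- by rewrite EE; exact: direct_sum_indic_model.
Qed.
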